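(* Let $\mathcal{C}$ be a fusion category of rank $n$ and let $\mathcal{D}$ be a fusion subcategory of $\mathcal{C}$ with maximal rank, i.e. $\mathcal{D}$ has rank $n-1$. Then $\mathcal{D}$ is an integral fusion category. In particular, $\mathcal{D}$ is (tensor equivalent to) the category of finite-dimensional representations of a semisimple quasi-Hopf algebra.
   Context: All fusion categories are over $\mathbb{C}$: a fusion category is a $\mathbb{C}$-linear semisimple rigid tensor category with finitely many isomorphism classes of simple objects, finite-dimensional Hom spaces and simple unit object $\mathbf{1}$. The rank of a fusion category is the number of isomorphism classes of its simple objects. A fusion category is integral if the Frobenius-Perron dimension of each simple object is an integer. *)

(* Defs.v *)
From HB Require Import structures.
From mathcomp Require Import all_boot all_order all_algebra all_field.
Set Implicit Arguments. Unset Strict Implicit. Unset Printing Implicit Defensive.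
Import GRing.Theory VectorInternalTheory.
Local Open Scope ring_scope.

(* Tensor product of vector spaces, through the coordinates in the bases given
   by [v2r]; [pure v w] is v ⊗ w and [tlift f] extends a bilinear [f]. *)
Definition tensor (K : fieldType) (V W : vectType K) : Type :=
  'M[K]_(dim V, dim W).
HB.instance Definition _ (K : fieldType) (V W : vectType K) :=
  Vector.copy (tensor V W) 'M[K]_(dim V, dim W).

Section Tensor.
Variable K : fieldType.
Implicit Types V W U Y Z : vectType K.

Definition basisv V (i : 'I_(dim V)) : V := r2v (delta_mx 0 i).

Definition pure V W (v : V) (w : W) : tensor V W := (v2r v)^T *m v2r w.

Definition tlift V W U (f : V -> W -> U) (t : tensor V W) : U :=
  \sum_i \sum_j (t : 'M[K]_(dim V, dim W)) i j *: f (basisv i) (basisv j).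

Definition bilin V W U (f : V -> W -> U) : Prop :=
  (forall w, linear (f^~ w)) /\ (forall v, linear (f v)).

Lemma tlift_is_linear V W U (f : V -> W -> U) : linear (tlift f).
Proof.
move=> a s t; rewrite /tlift scaler_sumr -big_split; apply: eq_bigr => i _ /=.
rewrite scaler_sumr -big_split; apply: eq_bigr => j _ /=.
by rewrite !mxE scalerDl scalerA.
Qed.

HB.instance Definition _ V W U (f : V -> W -> U) :=
  GRing.isLinear.Build K (tensor V W) U _ (tlift f) (tlift_is_linear f).

Lemma basisv_sum V (v : V) : v = \sum_i v2r v 0 i *: basisv i.
Proof.
apply: (can_inj v2rK); rewrite linear_sum /= {1}[v2r v]row_sum_delta.
by apply: eq_bigr => i _; rewrite linearZ /= /basisv r2vK.
Qed.

Lemma pureE V W (v : V) (w : W) i j :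
  (pure v w : 'M_(dim V, dim W)) i j = v2r v 0 i * v2r w 0 j.
Proof. by rewrite /pure !mxE big_ord1 !mxE. Qed.

Lemma pure_bilin V W : bilin (@pure V W).
Proof.
by split=> [w|v] a x y; apply/matrixP => i j;
  rewrite [RHS]mxE [in RHS]mxE !pureE linearP !mxE ?mulrDl ?mulrDr ?mulrA // [_ * a]mulrC.
Qed.

Lemma linear_scale V W (f : V -> W) a x : linear f -> f (a *: x) = a *: f x.
Proof.
move=> fl.
pose g := HB.pack_for {linear V -> W} f (GRing.isLinear.Build K V W _ _ fl).
exact: (linearZ_LR g).
Qed.

Lemma pure_linl V W (w : W) : linear (fun v : V => pure v w).
Proof. exact: (pure_bilin V W).1. Qed.
Lemma pure_linr V W (v : V) : linear (fun w : W => pure v w).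
Proof. exact: (pure_bilin V W).2. Qed.

Lemma bilin_suml V W U (f : V -> W -> U) (n : nat) c (s : 'I_n -> V) w : bilin f ->
  f (\sum_i c i *: s i) w = \sum_i c i *: f (s i) w.
Proof.
case=> fl _; pose g := HB.pack_for {linear V -> U} (f^~ w) (GRing.isLinear.Build K V U _ _ (fl w)).
by rewrite -[LHS]/(g _) linear_sum; apply: eq_bigr => i _; rewrite linearZ.
Qed.
Lemma bilin_sumr V W U (f : V -> W -> U) (n : nat) c (s : 'I_n -> W) v : bilin f ->
  f v (\sum_i c i *: s i) = \sum_i c i *: f v (s i).
Proof.
case=> _ fl; pose g := HB.pack_for {linear W -> U} (f v) (GRing.isLinear.Build K W U _ _ (fl v)).
by rewrite -[LHS]/(g _) linear_sum; apply: eq_bigr => i _; rewrite linearZ.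
Qed.

Lemma tlift_pure V W U (f : V -> W -> U) v w : bilin f -> tlift f (pure v w) = f v w.
Proof.
move=> fb; rewrite [v in RHS]basisv_sum bilin_suml //; apply: eq_bigr => i _.
rewrite [w in RHS]basisv_sum bilin_sumr // scaler_sumr; apply: eq_bigr => j _.
by rewrite pureE scalerA.
Qed.

Lemma tlift_id V W (t : tensor V W) : tlift (@pure V W) t = t.
Proof.
rewrite [RHS]matrix_sum_delta; apply: eq_bigr => i _; apply: eq_bigr => j _.
congr (_ *: _); apply/matrixP=> k l; rewrite pureE /basisv !r2vK !mxE /=.
by rewrite mulr_natl mulrb; case: eqP => //= _; case: eqP.
Qed.

Lemma tensor_ext V W U (f g : {linear tensor V W -> U}) :
  (forall v w, f (pure v w) = g (pure v w)) -> f =1 g.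
Proof.
move=> fg t; rewrite -(tlift_id t) /tlift !linear_sum; apply: eq_bigr => i _.
by rewrite !linear_sum; apply: eq_bigr => j _; rewrite !linearZ /= fg.
Qed.


Lemma tlift_param V W U Z (f : U -> V -> W -> Z) (t : tensor V W) :
  (forall v w, linear (fun u => f u v w)) -> linear (fun u => tlift (f u) t).
Proof.
move=> fl a x y; rewrite /tlift scaler_sumr -big_split; apply: eq_bigr => i _ /=.
rewrite scaler_sumr -big_split; apply: eq_bigr => j _ /=.
by rewrite fl scalerDr !scalerA [_ * a]mulrC.
Qed.

Definition tmap V W V' W' (f : V -> V') (g : W -> W') :
  tensor V W -> tensor V' W' := tlift (fun v w => pure (f v) (g w)).

HB.instance Definition _ V W V' W' (f : V -> V') (g : W -> W') :=
  GRing.isLinear.Build K (tensor V W) (tensor V' W') _ (tmap f g)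
    (tlift_is_linear _).

Lemma tmapP V V' W W' (f : V -> V') (g : W -> W') : linear (tmap f g).
Proof. exact: tlift_is_linear. Qed.

Lemma tmap_pure V W V' W' (f : V -> V') (g : W -> W') v w :
  linear f -> linear g -> tmap f g (pure v w) = pure (f v) (g w).
Proof.
move=> fl gl; rewrite /tmap tlift_pure //; split=> [w'|v'] a x y.
  by rewrite fl pure_linl.
by rewrite gl pure_linr.
Qed.

Definition tmap2 V W V' W' V'' W''
    (f : V -> V' -> V'') (g : W -> W' -> W'')
    (x : tensor V W) (y : tensor V' W') : tensor V'' W'' :=
  tlift (fun v w => tmap (f v) (g w) y) x.

Section Tmap2.
Variables (V W V' W' V'' W'' : vectType K).
Variables (f : V -> V' -> V'') (g : W -> W' -> W'').
Hypotheses (fb : bilin f) (gb : bilin g).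

Lemma tmap2_bilin : bilin (tmap2 f g).
Proof.
split=> [y|x]; first exact: tlift_is_linear.
by apply: tlift_param => v w; exact: tlift_is_linear.
Qed.

Lemma tmap2_pure v w v' w' :
  tmap2 f g (pure v w) (pure v' w') = pure (f v v') (g w w').
Proof.
rewrite /tmap2 tlift_pure; first by rewrite tmap_pure //; [apply: fb.2 | apply: gb.2].
split=> [u|u]; apply: tlift_param => s t a x y.
  by rewrite fb.1 pure_linl.
by rewrite gb.1 pure_linr.
Qed.
End Tmap2.

Definition tassoc V W U : tensor (tensor V W) U -> tensor V (tensor W U) :=
  tlift (fun t u => tlift (fun v w => pure v (pure w u)) t).

HB.instance Definition _ V W U :=
  GRing.isLinear.Build K (tensor (tensor V W) U) (tensor V (tensor W U)) _
    (@tassoc V W U) (tlift_is_linear _).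

Definition tassocV V W U : tensor V (tensor W U) -> tensor (tensor V W) U :=
  tlift (fun v t => tlift (fun w u => pure (pure v w) u) t).

HB.instance Definition _ V W U :=
  GRing.isLinear.Build K (tensor V (tensor W U)) (tensor (tensor V W) U) _
    (@tassocV V W U) (tlift_is_linear _).

Lemma tassoc_pure V W U (v : V) (w : W) (u : U) :
  tassoc (pure (pure v w) u) = pure v (pure w u).
Proof.
rewrite /tassoc tlift_pure ?tlift_pure //.
  by split=> [w'|v'] a x y; rewrite ?pure_linl ?pure_linr.
split=> [u'|t']; first exact: tlift_is_linear.
by apply: tlift_param => v' w' a x y; rewrite !pure_linr.
Qed.

Lemma tassocV_pure V W U (v : V) (w : W) (u : U) :
  tassocV (pure v (pure w u)) = pure (pure v w) u.
Proof.
rewrite /tassocV tlift_pure ?tlift_pure //.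
  by split=> [w'|v'] a x y; rewrite ?pure_linr ?pure_linl.
split=> [u'|t']; last exact: tlift_is_linear.
by apply: tlift_param => v' w' a x y; rewrite !pure_linl.
Qed.

Lemma tensor_extP V W U (f g : tensor V W -> U) : linear f -> linear g ->
  (forall v w, f (pure v w) = g (pure v w)) -> f =1 g.
Proof.
move=> fl gl.
pose f' := HB.pack_for {linear tensor V W -> U} f (GRing.isLinear.Build K _ U _ _ fl).
pose g' := HB.pack_for {linear tensor V W -> U} g (GRing.isLinear.Build K _ U _ _ gl).
exact: (@tensor_ext _ _ _ f' g').
Qed.

Lemma tensor_ext3 V W Y U (f g : tensor V (tensor W Y) -> U) :
  linear f -> linear g ->
  (forall v w y, f (pure v (pure w y)) = g (pure v (pure w y))) -> f =1 g.
Proof.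
move=> fl gl fg; apply: tensor_extP => // v; apply: tensor_extP => //.
  by move=> a x y; rewrite pure_linr fl.
by move=> a x y; rewrite pure_linr gl.
Qed.

Lemma tensor_ext3l V W Y U (f g : tensor (tensor V W) Y -> U) :
  linear f -> linear g ->
  (forall v w y, f (pure (pure v w) y) = g (pure (pure v w) y)) -> f =1 g.
Proof.
move=> fl gl fg; apply: tensor_extP => // + y.
apply: tensor_extP => //.
- by move=> a x z; rewrite pure_linl fl.
- by move=> a x z; rewrite pure_linl gl.
Qed.

Lemma tassocK V W U : cancel (@tassoc V W U) (@tassocV V W U).
Proof.
apply: tensor_ext3l => [a x y|a x y|v w u]; rewrite ?linearP //.
by rewrite tassoc_pure tassocV_pure.
Qed.

Lemma tassocVK V W U : cancel (@tassocV V W U) (@tassoc V W U).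
Proof.
apply: tensor_ext3 => [a x y|a x y|v w u]; rewrite ?linearP //.
by rewrite tassocV_pure tassoc_pure.
Qed.

Lemma tassoc_pentagon V W U Y (x : tensor (tensor (tensor V W) U) Y) :
  tmap idfun (@tassoc W U Y) (tassoc (tmap (@tassoc V W U) idfun x)) =
  tassoc (tassoc x).
Proof.
move: x; apply: tensor_extP.
- by move=> a u v; rewrite tmapP linearP tmapP.
- by move=> a u v; rewrite !linearP.
move=> + y; apply: tensor_extP.
- by move=> a u v; rewrite pure_linl tmapP linearP tmapP.
- by move=> a u v; rewrite pure_linl !linearP.
move=> + u; apply: tensor_extP.
- by move=> a v w; rewrite !pure_linl tmapP linearP tmapP.
- by move=> a v w; rewrite !pure_linl !linearP.
move=> v w; rewrite tmap_pure; [|exact: linearP|by []].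
rewrite !tassoc_pure tmap_pure; [|by []|exact: linearP].
by rewrite !tassoc_pure.
Qed.

End Tensor.

Section TensorAlgebra.
Variables (K : fieldType) (A B : falgType K).
Local Notation AB := (tensor A B).

Lemma mul_bilin (C : falgType K) : bilin ( *%R : C -> C -> C).
Proof. by split=> [y|x] a u v; rewrite (mulrDl, mulrDr) -(scalerAl, scalerAr). Qed.

Definition tmul : AB -> AB -> AB := @tmap2 K A B A B A B *%R *%R.
Definition tone : AB := pure 1 1.

Let tmb := @tmap2_bilin K A B A B A B *%R *%R.
Let tmP := @tmap2_pure K A B A B A B _ _ (mul_bilin A) (mul_bilin B).

Fact tmulA : associative tmul.
Proof.
rewrite /tmul => x y z; move: x.
apply: tensor_extP => [a u v|a u v|a b]; rewrite ?tmb.1 //; move: y.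
apply: tensor_extP => [e u v|e u v|c d]; rewrite ?tmb.1 ?tmb.2 ?tmb.1 //; move: z.
apply: tensor_extP => [e u v|e u v|e f]; rewrite ?tmb.2 //.
by rewrite !tmP !mulrA.
Qed.
Fact tmul1l : left_id tone tmul.
Proof.
rewrite /tmul; apply: tensor_extP => [e u v|e u v|a b] //; rewrite ?tmb.2 //.
by rewrite tmP !mul1r.
Qed.
Fact tmul1r : right_id tone tmul.
Proof.
rewrite /tmul; apply: tensor_extP => [e u v|e u v|a b] //; rewrite ?tmb.1 //.
by rewrite tmP !mulr1.
Qed.
Fact tmulDl : left_distributive tmul +%R.
Proof. by move=> x y z; have := tmb.1 z 1 x y; rewrite !scale1r. Qed.
Fact tmulDr : right_distributive tmul +%R.
Proof. by move=> x y z; have := tmb.2 x 1 y z; rewrite !scale1r. Qed.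
Fact tone_neq0 : tone != 0.
Proof.
have nz (C : falgType K) : exists i, v2r (1 : C) 0 i != 0.
  apply/existsP; apply: contraTT (oner_neq0 C); rewrite negb_exists negbK.
  move/forallP=> z; apply/eqP/(can_inj v2rK); rewrite linear0; apply/rowP=> i.
  by rewrite mxE; apply/eqP; have := z i; rewrite negbK.
have [[i ni] [j nj]] := (nz A, nz B).
apply/eqP=> /matrixP/(_ i j); rewrite pureE mxE => /eqP.
by rewrite mulf_eq0 (negPf ni) (negPf nj).
Qed.
HB.instance Definition _ := GRing.Zmodule_isNzRing.Build (tensor A B)
  tmulA tmul1l tmul1r tmulDl tmulDr tone_neq0.
Fact tscalerAl (a : K) (x y : AB) : a *: (x * y) = (a *: x) * y.
Proof. exact/esym/(linear_scale a x (tmb.1 y)). Qed.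
HB.instance Definition _ := GRing.Lmodule_isLalgebra.Build K (tensor A B) tscalerAl.
Fact tscalerAr (a : K) (x y : AB) : a *: (x * y) = x * (a *: y).
Proof. exact/esym/(linear_scale a y (tmb.2 x)). Qed.
HB.instance Definition _ := GRing.Lalgebra_isAlgebra.Build K (tensor A B) tscalerAr.
HB.instance Definition _ := Algebra_isFalgebra.Build K (tensor A B).
Lemma mul_pure (a c : A) (b d : B) : pure a b * pure c d = pure (a * c) (b * d).
Proof. exact: tmP. Qed.
Lemma one_pure : 1 = pure 1 1 :> AB.
Proof. by []. Qed.
End TensorAlgebra.


Declare Scope cat_scope.
Delimit Scope cat_scope with cat.
Local Open Scope cat_scope.

Record lin_category (K : fieldType) := LinCategory {
  obj :> Type;
  hom : obj -> obj -> vectType K;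
  idm : forall X, hom X X;
  comp : forall X Y Z, hom Y Z -> hom X Y -> hom X Z;
  comp_bilin : forall X Y Z, bilin (@comp X Y Z);
  compA : forall X Y Z W (h : hom Z W) (g : hom Y Z) (f : hom X Y),
    comp h (comp g f) = comp (comp h g) f;
  comp1m : forall X Y (f : hom X Y), comp (idm Y) f = f;
  compm1 : forall X Y (f : hom X Y), comp f (idm X) = f
}.

Arguments hom {K l} X Y.
Arguments idm {K l} X.
Arguments comp {K l X Y Z} g f.
Notation "g ∘ f" := (comp g f) (at level 40, left associativity) : cat_scope.

Section LinearCategories.
Variables (K : fieldType) (C : lin_category K).
Implicit Types X Y Z : C.

Definition inverse X Y (f : hom X Y) (g : hom Y X) : Prop :=
  g ∘ f = idm X /\ f ∘ g = idm Y.

Definition is_iso X Y (f : hom X Y) : Prop := exists g, inverse f g.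

Definition isomorphic X Y : Prop := exists f : hom X Y, is_iso f.

Definition is_mono X Y (f : hom X Y) : Prop :=
  forall Z (g h : hom Z X), f ∘ g = f ∘ h -> g = h.

Definition is_epi X Y (f : hom X Y) : Prop :=
  forall Z (g h : hom Y Z), g ∘ f = h ∘ f -> g = h.

Definition zero_object X : Prop :=
  forall Y, (forall f : hom X Y, f = 0) /\ (forall f : hom Y X, f = 0).

Definition direct_sum n (S : 'I_n -> C) X : Prop :=
  exists (inj : forall i, hom (S i) X) (proj : forall i, hom X (S i)),
    [/\ forall i, proj i ∘ inj i = idm (S i),
        forall i j, i != j -> proj i ∘ inj j = 0
      & \sum_i inj i ∘ proj i = idm X].

Definition is_kernel X Y A (f : hom X Y) (k : hom A X) : Prop :=
  f ∘ k = 0 /\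
  forall Z (g : hom Z X), f ∘ g = 0 -> exists! h : hom Z A, k ∘ h = g.

Definition is_cokernel X Y A (f : hom X Y) (q : hom Y A) : Prop :=
  q ∘ f = 0 /\
  forall Z (g : hom Y Z), g ∘ f = 0 -> exists! h : hom A Z, h ∘ q = g.

(* [direct_sum] with [n = 0] provides a zero object. *)
Definition abelian : Prop :=
  [/\ forall n (S : 'I_n -> C), exists X, direct_sum S X,
      forall X Y (f : hom X Y), exists A (k : hom A X), is_kernel f k,
      forall X Y (f : hom X Y), exists A (q : hom Y A), is_cokernel f q,
      forall X Y (f : hom X Y), is_mono f ->
        exists Z (g : hom Y Z), is_kernel g f
    & forall X Y (f : hom X Y), is_epi f ->
        exists Z (g : hom Z X), is_cokernel g f].

Definition simple_object X : Prop :=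
  ~ zero_object X /\
  forall Y (f : hom Y X), is_mono f -> zero_object Y \/ is_iso f.

Definition semisimple : Prop :=
  abelian /\
  forall X, exists n (S : 'I_n -> C),
    (forall i, simple_object (S i)) /\ direct_sum S X.

Definition simple_representatives n (S : 'I_n -> C) : Prop :=
  [/\ forall i, simple_object (S i),
      forall i j, isomorphic (S i) (S j) -> i = j
    & forall X, simple_object X -> exists i, isomorphic X (S i)].

Definition has_rank n : Prop := exists S : 'I_n -> C, simple_representatives S.

End LinearCategories.

Record lin_functor (K : fieldType) (C D : lin_category K) := LinFunctor {
  fob :> C -> D;
  fhom : forall X Y, hom X Y -> hom (fob X) (fob Y);
  fhom_linear : forall X Y, linear (@fhom X Y);
  fhom1 : forall X, fhom (idm X) = idm (fob X);
  fhomM : forall X Y Z (g : hom Y Z) (f : hom X Y),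
    fhom (g ∘ f) = fhom g ∘ fhom f
}.
Arguments fhom {K C D} l {X Y} f.

Definition id_functor (K : fieldType) (C : lin_category K) : lin_functor C C :=
  @LinFunctor K C C id (fun _ _ f => f) (fun _ _ _ _ _ => erefl)
    (fun _ => erefl) (fun _ _ _ _ _ => erefl).

Section ComposeFunctors.
Variables (K : fieldType) (C D E : lin_category K).
Variables (G : lin_functor D E) (F : lin_functor C D).

Fact comp_fhom_linear X Y : linear (fun f : hom X Y => fhom G (fhom F f)).
Proof. by move=> a f g; rewrite !fhom_linear. Qed.
Fact comp_fhom1 X : fhom G (fhom F (idm X)) = idm (G (F X)).
Proof. by rewrite !fhom1. Qed.
Fact comp_fhomM X Y Z (g : hom Y Z) (f : hom X Y) :
  fhom G (fhom F (g ∘ f)) = fhom G (fhom F g) ∘ fhom G (fhom F f).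
Proof. by rewrite !fhomM. Qed.

Definition comp_functor : lin_functor C E :=
  LinFunctor comp_fhom_linear comp_fhom1 comp_fhomM.
End ComposeFunctors.

Definition nat_iso (K : fieldType) (C D : lin_category K)
    (F G : lin_functor C D) : Prop :=
  exists eta : forall X, hom (F X) (G X),
    (forall X, is_iso (eta X)) /\
    (forall X Y (f : hom X Y), fhom G f ∘ eta X = eta Y ∘ fhom F f).

Definition is_equivalence (K : fieldType) (C D : lin_category K)
    (F : lin_functor C D) : Prop :=
  exists G : lin_functor D C,
    nat_iso (comp_functor G F) (id_functor C) /\
    nat_iso (comp_functor F G) (id_functor D).

Record monoidal_category (K : fieldType) := MonoidalCategory {
  mcat :> lin_category K;
  otimes : mcat -> mcat -> mcat;
  omap : forall X X' Y Y' : mcat,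
    hom X X' -> hom Y Y' -> hom (otimes X Y) (otimes X' Y');
  unitobj : mcat;
  assoc : forall X Y Z : mcat,
    hom (otimes (otimes X Y) Z) (otimes X (otimes Y Z));
  lunit : forall X : mcat, hom (otimes unitobj X) X;
  runit : forall X : mcat, hom (otimes X unitobj) X;
  omap_bilin : forall X X' Y Y' : mcat, bilin (@omap X X' Y Y');
  omap1 : forall X Y : mcat, omap (idm X) (idm Y) = idm (otimes X Y);
  omapM : forall (X X' X'' Y Y' Y'' : mcat)
    (f' : hom X' X'') (f : hom X X') (g' : hom Y' Y'') (g : hom Y Y'),
    omap (f' ∘ f) (g' ∘ g) = omap f' g' ∘ omap f g;
  assoc_iso : forall X Y Z, is_iso (assoc X Y Z);
  lunit_iso : forall X, is_iso (lunit X);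
  runit_iso : forall X, is_iso (runit X);
  assoc_nat : forall (X X' Y Y' Z Z' : mcat)
    (f : hom X X') (g : hom Y Y') (h : hom Z Z'),
    assoc X' Y' Z' ∘ omap (omap f g) h = omap f (omap g h) ∘ assoc X Y Z;
  lunit_nat : forall (X Y : mcat) (f : hom X Y),
    lunit Y ∘ omap (idm unitobj) f = f ∘ lunit X;
  runit_nat : forall (X Y : mcat) (f : hom X Y),
    runit Y ∘ omap f (idm unitobj) = f ∘ runit X;
  pentagon : forall X Y Z W : mcat,
    assoc X Y (otimes Z W) ∘ assoc (otimes X Y) Z W =
    omap (idm X) (assoc Y Z W) ∘ assoc X (otimes Y Z) W
      ∘ omap (assoc X Y Z) (idm W);
  triangle : forall X Y : mcat,
    omap (idm X) (lunit Y) ∘ assoc X unitobj Y = omap (runit X) (idm Y)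
}.

Arguments otimes {K m} X Y.
Arguments omap {K m X X' Y Y'} f g.
Arguments unitobj {K m}.
Arguments assoc {K m} X Y Z.
Arguments lunit {K m} X.
Arguments runit {K m} X.
Notation "X ⊗ Y" := (otimes X Y) (at level 40, left associativity) : cat_scope.
Notation "f ⊗m g" := (omap f g) (at level 40, left associativity) : cat_scope.
Notation "𝟙" := unitobj : cat_scope.

Section MonoidalCategories.
Variables (K : fieldType) (C : monoidal_category K).

Definition left_dual (X Xd : C) : Prop :=
  exists (ev : hom (Xd ⊗ X) 𝟙) (coev : hom 𝟙 (X ⊗ Xd))
    (assocV : hom (Xd ⊗ (X ⊗ Xd)) (Xd ⊗ X ⊗ Xd)),
    [/\ inverse (assoc Xd X Xd) assocV,
        runit X ∘ (idm X ⊗m ev) ∘ assoc X Xd X ∘ (coev ⊗m idm X) = lunit X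
      & lunit Xd ∘ (ev ⊗m idm Xd) ∘ assocV ∘ (idm Xd ⊗m coev) = runit Xd].

Definition rigid : Prop :=
  forall X : C, (exists Xd, left_dual X Xd) /\ (exists dX, left_dual dX X).

Definition is_fusion : Prop :=
  [/\ semisimple C, rigid, exists n, has_rank C n & simple_object (𝟙 : C)].

(* The matrix of multiplication by [X] in the Grothendieck ring, in the basis
   of the classes of the [S i]; over an algebraically closed field the
   multiplicity of the simple object [S i] in [Y] is dim Hom (S i, Y). *)
Definition fusion_matrix (F : nzRingType) n (S : 'I_n -> C) (X : C) : 'M[F]_n :=
  \matrix_(i, j) (\dim {: hom (S i) (X ⊗ S j)})%:R.

(* The Frobenius-Perron dimension is the largest nonnegative eigenvalue. *)
Definition is_FPdim (R : realFieldType) n (S : 'I_n -> C) (X : C) (d : R) :=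
  [/\ 0 <= d, eigenvalue (fusion_matrix R S X) d
    & forall x, eigenvalue (fusion_matrix R S X) x -> x <= d].

Definition is_integral (R : realFieldType) : Prop :=
  forall n (S : 'I_n -> C), simple_representatives S ->
  forall X : C, simple_object X -> exists m : int, is_FPdim S X (m%:~R : R).

End MonoidalCategories.

Definition monoidal_functor (K : fieldType) (C D : monoidal_category K)
    (F : lin_functor C D) : Prop :=
  exists (J : forall X Y, hom (F X ⊗ F Y) (F (X ⊗ Y))) (J1 : hom 𝟙 (F 𝟙)),
  [/\ (forall X Y, is_iso (J X Y)) /\ is_iso J1,
      forall X X' Y Y' (f : hom X X') (g : hom Y Y'),
        J X' Y' ∘ (fhom F f ⊗m fhom F g) = fhom F (f ⊗m g) ∘ J X Y,
      forall X Y Z,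
        fhom F (assoc X Y Z) ∘ J (X ⊗ Y) Z ∘ (J X Y ⊗m idm (F Z)) =
        J X (Y ⊗ Z) ∘ (idm (F X) ⊗m J Y Z) ∘ assoc (F X) (F Y) (F Z),
      forall X, fhom F (lunit X) ∘ J 𝟙 X ∘ (J1 ⊗m idm (F X)) = lunit (F X)
    & forall X, fhom F (runit X) ∘ J X 𝟙 ∘ (idm (F X) ⊗m J1) = runit (F X)].

Definition tensor_equivalent (K : fieldType) (C D : monoidal_category K) :=
  exists F : lin_functor C D, is_equivalence F /\ monoidal_functor F.

(* A full subcategory, given by its class of objects; [sub_retract] is closure
   under direct summands, and in particular under isomorphism. *)
Record fusion_subcategory (K : fieldType) (C : monoidal_category K) :=
  FusionSubcategory {
  subobj :> C -> Prop;
  sub_retract : forall (X Y : C) (i : hom X Y) (p : hom Y X),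
    p ∘ i = idm X -> subobj Y -> subobj X;
  sub_direct_sum : forall n (S : 'I_n -> C) X,
    (forall i, subobj (S i)) -> direct_sum S X -> subobj X;
  sub_unit : subobj 𝟙;
  sub_otimes : forall X Y, subobj X -> subobj Y -> subobj (X ⊗ Y);
  sub_left_dual : forall X Y, left_dual X Y -> subobj X -> subobj Y;
  sub_right_dual : forall X Y, left_dual X Y -> subobj Y -> subobj X
}.

Section FullSubcategory.
Variables (K : fieldType) (C : monoidal_category K).
Variable D : fusion_subcategory C.

Definition sub_lin_category : lin_category K :=
  @LinCategory K {X : C | D X} (fun X Y => hom (sval X) (sval Y))
    (fun X => idm (sval X)) (fun X Y Z g f => g ∘ f)
    (fun X Y Z => @comp_bilin K C (sval X) (sval Y) (sval Z))
    (fun X Y Z W h g f => compA h g f)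
    (fun X Y f => comp1m f) (fun X Y f => compm1 f).

Definition sub_monoidal_category : monoidal_category K :=
  @MonoidalCategory K sub_lin_category
    (fun X Y => exist _ (sval X ⊗ sval Y) (sub_otimes (svalP X) (svalP Y)))
    (fun X X' Y Y' f g => f ⊗m g)
    (exist _ 𝟙 (sub_unit D))
    (fun X Y Z => assoc (sval X) (sval Y) (sval Z))
    (fun X => lunit (sval X)) (fun X => runit (sval X))
    (fun X X' Y Y' => @omap_bilin K C _ _ _ _)
    (fun X Y => omap1 _ _)
    (fun X X' X'' Y Y' Y'' f' f g' g => omapM f' f g' g)
    (fun X Y Z => assoc_iso _ _ _)
    (fun X => lunit_iso _) (fun X => runit_iso _)
    (fun X X' Y Y' Z Z' f g h => assoc_nat f g h)
    (fun X Y f => lunit_nat f) (fun X Y f => runit_nat f)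
    (fun X Y Z W => pentagon _ _ _ _) (fun X Y => triangle _ _).
End FullSubcategory.
Coercion sub_monoidal_category : fusion_subcategory >-> monoidal_category.

(* The associator acts as (V ⊗ W) ⊗ U -> V ⊗ (W ⊗ U). All the axioms are
   stated with tensor powers of the algebra bracketed to the right. *)
Record quasi_bialgebra (K : fieldType) := QuasiBialgebra {
  qalg :> falgType K;
  comul : {lrmorphism qalg -> tensor qalg qalg};
  counit : {lrmorphism qalg -> K^o};
  Phi : tensor qalg (tensor qalg qalg);
  Phi_unit : Phi \is a GRing.unit;
  comul_coassoc : forall h,
    tmap idfun comul (comul h) =
    Phi * tassoc (tmap comul idfun (comul h)) * Phi^-1;
  counitl : forall h, tlift (fun a b => counit a *: b) (comul h) = h;
  counitr : forall h, tlift (fun a b => counit b *: a) (comul h) = h;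
  Phi_pentagon :
    tmap idfun (tmap idfun comul) Phi * tassoc (tmap comul idfun Phi) =
    pure 1 Phi * tmap idfun (@tassoc _ _ _ _) (tmap idfun (tmap comul idfun) Phi)
      * tmap idfun (@tassoc _ _ _ _) (tassoc (pure Phi 1))
      :> tensor qalg (tensor qalg (tensor qalg qalg));
  Phi_counit : tmap idfun (tlift (fun a b => counit a *: b)) Phi = pure 1 1
}.

Arguments comul {K q}.
Arguments counit {K q}.

Record quasi_hopf_algebra (K : fieldType) := QuasiHopfAlgebra {
  qbialg :> quasi_bialgebra K;
  antipode : {linear qbialg -> qbialg};
  alpha : qbialg;
  beta : qbialg;
  antipode1 : antipode 1 = 1;
  antipodeM : forall a b, antipode (a * b) = antipode b * antipode a;
  antipode_bij : bijective antipode;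
  antipode_alpha : forall h,
    tlift (fun a b => antipode a * alpha * b) (comul h) = counit h *: alpha;
  antipode_beta : forall h,
    tlift (fun a b => a * beta * antipode b) (comul h) = counit h *: beta;
  antipode_Phi :
    tlift (fun a => tlift (fun b c =>
      a * beta * antipode b * alpha * c)) (Phi qbialg) = 1;
  antipode_PhiV :
    tlift (fun a => tlift (fun b c =>
      antipode a * alpha * b * beta * antipode c)) (Phi qbialg)^-1 = 1
}.

Definition left_ideal (K : fieldType) (A : falgType K) (I : {vspace A}) :=
  (fullv * I <= I)%VS.

(* The left regular module is completely reducible. *)
Definition semisimple_algebra (K : fieldType) (A : falgType K) : Prop :=
  forall I : {vspace A}, left_ideal I ->
  exists J : {vspace A},
    [/\ left_ideal J, (I + J = fullv)%VS & (I :&: J = 0)%VS].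

Record module (K : fieldType) (A : falgType K) := Module {
  carrier :> vectType K;
  act : A -> carrier -> carrier;
  act_bilin : bilin act;
  act1 : forall v, act 1 v = v;
  actM : forall a b v, act (a * b) v = act a (act b v)
}.
Arguments act {K A m} a v.

Section ExternalProduct.
Variables (K : fieldType) (A B : falgType K) (V : module A) (W : module B).

Definition ext_act : tensor A B -> tensor V W -> tensor V W :=
  @tmap2 K A B V W V W act act.

Lemma ext_act_pure a b (v : V) (w : W) :
  ext_act (pure a b) (pure v w) = pure (act a v) (act b w).
Proof. exact: (tmap2_pure (act_bilin V) (act_bilin W)). Qed.

Fact ext_act_bilin : bilin ext_act.
Proof. exact: tmap2_bilin. Qed.
Fact ext_act1 x : ext_act 1 x = x.
Proof.
move: x; apply: tensor_extP => // [e u v|v w]; first by rewrite ext_act_bilin.2.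
by rewrite ext_act_pure !act1.
Qed.
Fact ext_actM a b x : ext_act (a * b) x = ext_act a (ext_act b x).
Proof.
have [El Er] := ext_act_bilin.
move: a; apply: tensor_extP => [e u v|e u v|a1 a2]; rewrite ?mulrDl -?scalerAl ?El //.
move: b; apply: tensor_extP => [e u v|e u v|b1 b2].
- by rewrite mulrDr -scalerAr El.
- by rewrite El Er.
move: x; apply: tensor_extP => [e u v|e u v|v w]; rewrite ?Er //.
by rewrite mul_pure !ext_act_pure !actM.
Qed.
Definition ext_module : module (tensor A B) :=
  Module ext_act_bilin ext_act1 ext_actM.
End ExternalProduct.

Section Restriction.
Variables (K : fieldType) (A B : falgType K) (f : {lrmorphism A -> B}).
Variable V : module B.
Definition res_act (a : A) (v : V) : V := act (f a) v.
Fact res_act_bilin : bilin res_act.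
Proof.
split=> [w|v] a x y; rewrite /res_act; last by rewrite (act_bilin V).2.
by rewrite linearP (act_bilin V).1.
Qed.
Fact res_act1 v : res_act 1 v = v.
Proof. by rewrite /res_act rmorph1 act1. Qed.
Fact res_actM a b v : res_act (a * b) v = res_act a (res_act b v).
Proof. by rewrite /res_act rmorphM actM. Qed.
Definition res_module : module A := Module res_act_bilin res_act1 res_actM.
End Restriction.

Section Intertwiners.
Variables (K : fieldType) (A : falgType K) (V W : module A).

Definition defect (f : 'Hom(V, W)) : 'Hom(tensor A V, W) :=
  linfun (tlift (fun a v => f (act a v) - act a (f v))).

Lemma defect_bilin (f : 'Hom(V, W)) :
  bilin (fun a v => f (act a v) - act a (f v)).
Proof.
have [[Vl Vr] [Wl Wr]] := (act_bilin V, act_bilin W).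
split=> [v|a] c x y.
  by rewrite Vl Wl linearP scalerBr opprD addrACA.
by rewrite Vr !linearP Wr scalerBr opprD addrACA.
Qed.

Fact defect_linear : linear defect.
Proof.
move=> a f g; apply/lfunP=> t; rewrite add_lfunE scale_lfunE !lfunE /=.
move: t; apply: tensor_extP.
- exact: tlift_is_linear.
- by move=> c x y; rewrite !(tlift_is_linear _ c) !scalerDr !scalerA [a * c]mulrC addrACA.
move=> b v; rewrite !tlift_pure; try exact: defect_bilin.
by rewrite !(add_lfunE, scale_lfunE) (act_bilin W).2 scalerBr opprD addrACA.
Qed.
HB.instance Definition _ :=
  GRing.isLinear.Build K 'Hom(V, W) 'Hom(tensor A V, W) _ defect defect_linear.

Definition intertwiners : {vspace 'Hom(V, W)} := lker (linfun defect).

Lemma intertwinersP (f : 'Hom(V, W)) :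
  reflect (forall a v, f (act a v) = act a (f v)) (f \in intertwiners).
Proof.
rewrite memv_ker lfunE; apply: (iffP eqP) => [df a v | fA].
  apply/eqP; rewrite -subr_eq0; apply/eqP.
  have /lfunP/(_ (pure a v)) := df.
  by rewrite zero_lfunE lfunE /= tlift_pure //; exact: defect_bilin.
apply/lfunP=> t; rewrite zero_lfunE lfunE /=.
rewrite /tlift big1 // => i _; rewrite big1 // => j _.
by rewrite fA subrr scaler0.
Qed.

Definition rep_hom : vectType K := subvs_of intertwiners.

Definition mk_rep_hom (f : 'Hom(V, W)) (fA : forall a v, f (act a v) = act a (f v)) :
  rep_hom := Subvs (introT (intertwinersP f) fA).

Lemma rep_homA (f : rep_hom) a v : vsval f (act a v) = act a (vsval f v).
Proof. by apply/intertwinersP: a v; apply: subvsP. Qed.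

Lemma rep_hom_ext (f g : rep_hom) : (forall v, vsval f v = vsval g v) -> f = g.
Proof. by move=> fg; apply/val_inj/lfunP. Qed.
End Intertwiners.

Section RepCategory.
Variables (K : fieldType) (A : falgType K).
Implicit Types V W U : module A.

Fact rep_id_subproof V a (v : V) :
  (\1%VF : 'Hom(V, V)) (act a v) = act a ((\1%VF : 'Hom(V, V)) v).
Proof. by rewrite !id_lfunE. Qed.
Definition rep_id V : rep_hom V V := mk_rep_hom (@rep_id_subproof V).

Fact rep_comp_subproof V W U (g : rep_hom W U) (f : rep_hom V W) a v :
  (vsval g \o vsval f)%VF (act a v) = act a ((vsval g \o vsval f)%VF v).
Proof. by rewrite !comp_lfunE /= !rep_homA. Qed.
Definition rep_comp V W U (g : rep_hom W U) (f : rep_hom V W) : rep_hom V U :=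
  mk_rep_hom (rep_comp_subproof g f).

Lemma rep_compE V W U (g : rep_hom W U) (f : rep_hom V W) v :
  vsval (rep_comp g f) v = vsval g (vsval f v).
Proof. exact: comp_lfunE. Qed.
Lemma rep_idE V v : vsval (rep_id V) v = v.
Proof. exact: id_lfunE. Qed.

Fact rep_comp_bilin V W U : bilin (@rep_comp V W U).
Proof.
split=> [f|g] a x y; apply: rep_hom_ext => v.
  by rewrite rep_compE linearP /= !add_lfunE !scale_lfunE !rep_compE.
by rewrite rep_compE !linearP /= !(add_lfunE, scale_lfunE, rep_compE) linearP.
Qed.
Fact rep_compA V W U Y (h : rep_hom U Y) (g : rep_hom W U) (f : rep_hom V W) :
  rep_comp h (rep_comp g f) = rep_comp (rep_comp h g) f.
Proof. by apply: rep_hom_ext => v; rewrite !rep_compE. Qed.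
Fact rep_comp1m V W (f : rep_hom V W) : rep_comp (rep_id W) f = f.
Proof. by apply: rep_hom_ext => v; rewrite rep_compE rep_idE. Qed.
Fact rep_compm1 V W (f : rep_hom V W) : rep_comp f (rep_id V) = f.
Proof. by apply: rep_hom_ext => v; rewrite rep_compE rep_idE. Qed.

Definition rep_lin_category : lin_category K :=
  LinCategory rep_comp_bilin rep_compA rep_comp1m rep_compm1.

Lemma rep_is_iso V W (f : rep_hom V W) (g : W -> V) :
  linear g -> cancel (vsval f) g -> cancel g (vsval f) ->
  @is_iso K rep_lin_category V W f.
Proof.
move=> gl fK gK.
pose g' : 'Hom(W, V) :=
  linfun (HB.pack_for {linear W -> V} g (GRing.isLinear.Build K W V _ _ gl)).
have g'E w : g' w = g w by rewrite lfunE.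
have gA a w : g' (act a w) = act a (g' w).
  by rewrite !g'E -[in LHS](gK w) -rep_homA fK.
exists (mk_rep_hom gA); split; apply: rep_hom_ext => v.
  by rewrite rep_compE rep_idE /= g'E fK.
by rewrite rep_compE rep_idE /= g'E gK.
Qed.
End RepCategory.

Section RepMonoidal.
Variables (K : fieldType) (H : quasi_bialgebra K).
Implicit Types V W U Y : module H.

(* The action on V ⊗ W is that of [tensor H H] restricted along [comul]. *)
Definition rep_tensor V W : module H := res_module comul (ext_module V W).

Definition unit_act (a : H) (x : K^o) : K^o := counit a * x.
Fact unit_act_bilin : bilin unit_act.
Proof.
split=> [w|v] a x y; rewrite /unit_act ?linearP.
  by rewrite mulrDl -scalerAl.
by rewrite mulrDr -scalerAr.
Qed.
Fact unit_act1 v : unit_act 1 v = v.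
Proof. by rewrite /unit_act rmorph1 mul1r. Qed.
Fact unit_actM a b v : unit_act (a * b) v = unit_act a (unit_act b v).
Proof. by rewrite /unit_act rmorphM mulrA. Qed.
Definition rep_unit : module H := Module unit_act_bilin unit_act1 unit_actM.

Lemma tmap_ext_act (A B : falgType K) (V V' : module A) (W W' : module B)
    (f : V -> V') (g : W -> W') :
  linear f -> linear g -> (forall a v, f (act a v) = act a (f v)) ->
  (forall b w, g (act b w) = act b (g w)) ->
  forall t x, tmap f g (ext_act t x) = ext_act t (tmap f g x).
Proof.
move=> fl gl fA gA t x.
have [El Er] := ext_act_bilin V W; have [El' Er'] := ext_act_bilin V' W'.
have Ml := @tlift_is_linear K V W _ (fun v w => pure (f v) (g w)).
rewrite -/(tmap f g) in Ml.
move: t; apply: tensor_extP => [e u v|e u v|a b]; rewrite ?El ?Ml ?El' //.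
move: x; apply: tensor_extP => [e u v|e u v|v w]; rewrite ?Er ?Ml ?Er' //.
by rewrite ext_act_pure !tmap_pure // ext_act_pure fA gA.
Qed.

Fact rep_omap_subproof V V' W W' (f : rep_hom V V') (g : rep_hom W W') a
    (x : rep_tensor V W) :
  linfun (tmap (vsval f) (vsval g)) (act a x) =
  act a (linfun (tmap (vsval f) (vsval g)) x : rep_tensor V' W').
Proof.
rewrite !lfunE /=; apply: tmap_ext_act; try exact: linearP.
- exact: rep_homA.
- exact: rep_homA.
Qed.
Definition rep_omap V V' W W' (f : rep_hom V V') (g : rep_hom W W') :
  rep_hom (rep_tensor V W) (rep_tensor V' W') :=
  @mk_rep_hom K H (rep_tensor V W) (rep_tensor V' W')
    (linfun (tmap (vsval f) (vsval g))) (rep_omap_subproof f g).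

Lemma rep_omapE V V' W W' (f : rep_hom V V') (g : rep_hom W W') x :
  vsval (rep_omap f g) x = tmap (vsval f) (vsval g) x.
Proof. exact: lfunE. Qed.

(* The action of H ⊗ (H ⊗ H) on V ⊗ (W ⊗ U). *)
Definition act3 V W U : tensor H (tensor H H) -> tensor V (tensor W U) ->
  tensor V (tensor W U) := @ext_act K _ _ V (ext_module W U).
Lemma act3_linear V W U t : linear (@act3 V W U t).
Proof. exact: (act_bilin (ext_module V (ext_module W U))).2. Qed.
Definition Phi_act V W U (x : tensor (tensor V W) U) := act3 (Phi H) (tassoc x).
Fact Phi_act_linear V W U : linear (@Phi_act V W U).
Proof. by move=> a x y; rewrite /Phi_act linearP act3_linear. Qed.
HB.instance Definition _ V W U := GRing.isLinear.Build K
  (tensor (tensor V W) U) (tensor V (tensor W U)) _ _ (@Phi_act_linear V W U).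

Lemma ext_act_resr (A B C : falgType K) (f : {lrmorphism B -> C})
    (V : module A) (W : module C) t (x : tensor V W) :
  @ext_act K A B V (res_module f W) t x = ext_act (tmap idfun f t) x.
Proof.
have [El Er] := ext_act_bilin V (res_module f W).
have [El' Er'] := ext_act_bilin V W.
move: t; apply: tensor_extP => [e u v|e u v|a b]; rewrite ?El ?linearP ?El' //.
move: x; apply: tensor_extP => [e u v|e u v|v w]; rewrite ?Er ?Er' //.
rewrite tmap_pure; [|by []|exact: linearP]; rewrite !ext_act_pure //.
Qed.

Lemma ext_act_resl (A B C : falgType K) (f : {lrmorphism A -> C})
    (V : module C) (W : module B) t (x : tensor V W) :
  @ext_act K A B (res_module f V) W t x = ext_act (tmap f idfun t) x.
Proof.
have [El Er] := ext_act_bilin (res_module f V) W.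
have [El' Er'] := ext_act_bilin V W.
move: t; apply: tensor_extP => [e u v|e u v|a b]; rewrite ?El ?linearP ?El' //.
move: x; apply: tensor_extP => [e u v|e u v|v w]; rewrite ?Er ?Er' //.
rewrite tmap_pure; [|exact: linearP|by []]; rewrite !ext_act_pure //.
Qed.

Lemma tassoc_act (A B C : falgType K) (V : module A) (W : module B)
    (U : module C) t x :
  tassoc (@ext_act K _ _ (ext_module V W) U t x) =
  @ext_act K _ _ V (ext_module W U) (tassoc t) (tassoc x).
Proof.
have [El Er] := ext_act_bilin (ext_module V W) U.
have [El' Er'] := ext_act_bilin V (ext_module W U).
move: t; apply: tensor_ext3l => [e u v|e u v|a b c]; rewrite ?El ?linearP ?El' //.
move: x; apply: tensor_ext3l => [e u v|e u v|v w u];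
  rewrite ?Er ?linearP ?Er' //.
rewrite !tassoc_pure.
rewrite (ext_act_pure (V:=ext_module V W) (W:=U)) (ext_act_pure (V:=V) (W:=ext_module W U)).
by rewrite /= !ext_act_pure tassoc_pure.
Qed.

Fact rep_assoc_subproof V W U a (x : rep_tensor (rep_tensor V W) U) :
  linfun (@Phi_act V W U) (act a x) = 
  act a (linfun (@Phi_act V W U) x : rep_tensor V (rep_tensor W U)).
Proof.
rewrite !lfunE /= /res_act /Phi_act /= !ext_act_resl !ext_act_resr.
rewrite comul_coassoc tassoc_act /act3 /= -!ext_actM.
by rewrite -!mulrA mulVr ?Phi_unit ?mulr1.
Qed.
Definition rep_assoc V W U : 
  rep_hom (rep_tensor (rep_tensor V W) U) (rep_tensor V (rep_tensor W U)) :=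
  @mk_rep_hom K H (rep_tensor (rep_tensor V W) U)
    (rep_tensor V (rep_tensor W U)) (linfun (@Phi_act V W U))
    (@rep_assoc_subproof V W U).

Lemma rep_assocE V W U x :
  vsval (rep_assoc V W U) x = act3 (Phi H) (tassoc x).
Proof. exact: lfunE. Qed.

Definition lunit_fun V : tensor K^o V -> V :=
  tlift (fun (c : K^o) (v : V) => (c : K) *: v).
HB.instance Definition _ V := GRing.isLinear.Build K (tensor K^o V) V _
  (@lunit_fun V) (tlift_is_linear _).
Lemma lunit_pure V (c : K^o) (v : V) : lunit_fun (pure c v) = (c : K) *: v.
Proof.
rewrite /lunit_fun tlift_pure //; split=> [w|w] a x y.
  by rewrite scalerDl scalerA.
by rewrite scalerDr !scalerA mulrC.
Qed.
Definition runit_fun V : tensor V K^o -> V :=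
  tlift (fun (v : V) (c : K^o) => (c : K) *: v).
HB.instance Definition _ V := GRing.isLinear.Build K (tensor V K^o) V _
  (@runit_fun V) (tlift_is_linear _).
Lemma runit_pure V (v : V) (c : K^o) : runit_fun (pure v c) = (c : K) *: v.
Proof.
rewrite /runit_fun tlift_pure //; split=> [w|w] a x y.
  by rewrite scalerDr !scalerA mulrC.
by rewrite scalerDl scalerA.
Qed.

Lemma counitl_bilin : bilin (fun a b : H => (counit a : K) *: b).
Proof.
split=> [w|w] a x y; first by rewrite linearP scalerDl scalerA.
by rewrite scalerDr !scalerA mulrC.
Qed.
Lemma counitr_bilin : bilin (fun a b : H => (counit b : K) *: a).
Proof.
split=> [w|w] a x y; last by rewrite linearP scalerDl scalerA.
by rewrite scalerDr !scalerA mulrC.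
Qed.

Lemma lunit_act V t (x : tensor K^o V) :
  lunit_fun (@ext_act K H H rep_unit V t x) =
  act (tlift (fun a b => (counit a : K) *: b) t) (lunit_fun x).
Proof.
have [El Er] := ext_act_bilin rep_unit V; have [Al Ar] := act_bilin V.
move: t; apply: tensor_extP => [e u v|e u v|a b]; rewrite ?El ?linearP ?Al //.
move: x; apply: tensor_extP => [e u v|e u v|c v]; rewrite ?Er ?linearP ?Ar //.
rewrite (ext_act_pure (V := rep_unit)) !lunit_pure tlift_pure; last exact: counitl_bilin.
have Z (s : K) d (w : V) : act (s *: d) w = s *: act d w.
  exact: (linear_scale s d (Al w)).
have Z' (s : K) d (w : V) : act d (s *: w) = s *: act d w.
  exact: (linear_scale s w (Ar d)).
by rewrite Z Z' scalerA.
Qed.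
Lemma runit_act V t (x : tensor V K^o) :
  runit_fun (@ext_act K H H V rep_unit t x) =
  act (tlift (fun a b => (counit b : K) *: a) t) (runit_fun x).
Proof.
have [El Er] := ext_act_bilin V rep_unit; have [Al Ar] := act_bilin V.
move: t; apply: tensor_extP => [e u v|e u v|a b]; rewrite ?El ?linearP ?Al //.
move: x; apply: tensor_extP => [e u v|e u v|v c]; rewrite ?Er ?linearP ?Ar //.
rewrite (ext_act_pure (W := rep_unit)) !runit_pure tlift_pure; last exact: counitr_bilin.
have Z (s : K) d (w : V) : act (s *: d) w = s *: act d w.
  exact: (linear_scale s d (Al w)).
have Z' (s : K) d (w : V) : act d (s *: w) = s *: act d w.
  exact: (linear_scale s w (Ar d)).
by rewrite Z Z' scalerA.
Qed.

Fact rep_lunit_subproof V a (x : rep_tensor rep_unit V) :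
  linfun (@lunit_fun V) (act a x) = act a (linfun (@lunit_fun V) x : V).
Proof. by rewrite !lfunE /= lunit_act counitl. Qed.
Definition rep_lunit V : rep_hom (rep_tensor rep_unit V) V :=
  @mk_rep_hom K H (rep_tensor rep_unit V) V (linfun (@lunit_fun V))
    (@rep_lunit_subproof V).
Fact rep_runit_subproof V a (x : rep_tensor V rep_unit) :
  linfun (@runit_fun V) (act a x) = act a (linfun (@runit_fun V) x : V).
Proof. by rewrite !lfunE /= runit_act counitr. Qed.
Definition rep_runit V : rep_hom (rep_tensor V rep_unit) V :=
  @mk_rep_hom K H (rep_tensor V rep_unit) V (linfun (@runit_fun V))
    (@rep_runit_subproof V).
Lemma rep_lunitE V x : vsval (rep_lunit V) x = lunit_fun x.
Proof. exact: lfunE. Qed.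
Lemma rep_runitE V x : vsval (rep_runit V) x = runit_fun x.
Proof. exact: lfunE. Qed.

Local Notation Rep0 := (rep_lin_category H).

Fact rep_lunit_iso V : @is_iso K Rep0 _ _ (rep_lunit V).
Proof.
apply: (@rep_is_iso K H (rep_tensor rep_unit V) V (rep_lunit V)
  (fun v => pure (1 : K^o) v : tensor K^o V)).
- exact: pure_linr.
- move=> x; rewrite rep_lunitE; move: x.
  apply: tensor_extP => [a x y|a x y|c v] //; first by rewrite linearP pure_linr.
  rewrite lunit_pure (linear_scale _ _ (pure_linr _)).
  rewrite -(linear_scale _ _ (pure_linl _)).
  by rewrite -[c *: (1 : K^o)]/(c * 1) mulr1.
- by move=> v; rewrite rep_lunitE lunit_pure scale1r.
Qed.
Fact rep_runit_iso V : @is_iso K Rep0 _ _ (rep_runit V).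
Proof.
apply: (@rep_is_iso K H (rep_tensor V rep_unit) V (rep_runit V)
  (fun v => pure v (1 : K^o) : tensor V K^o)).
- exact: pure_linl.
- move=> x; rewrite rep_runitE; move: x.
  apply: tensor_extP => [a x y|a x y|v c] //; first by rewrite linearP pure_linl.
  rewrite runit_pure (linear_scale _ _ (pure_linl _)).
  rewrite -(linear_scale _ _ (pure_linr _)).
  by rewrite -[c *: (1 : K^o)]/(c * 1) mulr1.
- by move=> v; rewrite rep_runitE runit_pure scale1r.
Qed.
Fact rep_assoc_iso V W U : @is_iso K Rep0 _ _ (rep_assoc V W U).
Proof.
apply: (@rep_is_iso K H (rep_tensor (rep_tensor V W) U)
  (rep_tensor V (rep_tensor W U)) (rep_assoc V W U)
  (fun x => tassocV (act3 (Phi H)^-1 x))).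
- by move=> a x y; rewrite act3_linear linearP.
- move=> x; rewrite rep_assocE /act3 -ext_actM mulVr ?Phi_unit // ext_act1.
  exact: tassocK.
- move=> x; rewrite rep_assocE tassocVK /act3 -ext_actM mulrV ?Phi_unit // ext_act1 //.
Qed.


Fact rep_omap_bilin V V' W W' : bilin (@rep_omap V V' W W').
Proof.
split=> [g|f] a x y; apply: rep_hom_ext => t.
  rewrite rep_omapE [in RHS]linearP add_lfunE scale_lfunE !rep_omapE; move: t.
  apply: tensor_extP => [e u v|e u v|v w]; rewrite ?tmapP //.
    by rewrite !scalerDr !scalerA [a * e]mulrC addrACA.
  rewrite !tmap_pure; try exact: linearP.
  by rewrite linearP add_lfunE scale_lfunE pure_linl.
rewrite rep_omapE [in RHS]linearP add_lfunE scale_lfunE !rep_omapE; move: t.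
apply: tensor_extP => [e u v|e u v|v w]; rewrite ?tmapP //.
  by rewrite !scalerDr !scalerA [a * e]mulrC addrACA.
rewrite !tmap_pure; try exact: linearP.
by rewrite linearP add_lfunE scale_lfunE pure_linr.
Qed.
Fact rep_omap1 V W :
  rep_omap (rep_id V) (rep_id W) = rep_id (rep_tensor V W).
Proof.
apply: rep_hom_ext => x; rewrite rep_omapE rep_idE; move: x.
apply: tensor_extP => [e u v|e u v|v w] /=; rewrite ?tmapP //.
by rewrite tmap_pure; try exact: linearP; rewrite !id_lfunE.
Qed.
Fact rep_omapM V V' V'' W W' W'' (f' : rep_hom V' V'') (f : rep_hom V V')
    (g' : rep_hom W' W'') (g : rep_hom W W') :
  rep_omap (rep_comp f' f) (rep_comp g' g) =
  rep_comp (rep_omap f' g') (rep_omap f g).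
Proof.
apply: rep_hom_ext => x; rewrite rep_compE !rep_omapE; move: x.
apply: tensor_extP => [e u v|e u v|v w] /=; rewrite ?tmapP //.
by rewrite !tmap_pure ?rep_compE //; try exact: linearP.
Qed.
Fact rep_assoc_nat V V' W W' U U' (f : rep_hom V V') (g : rep_hom W W')
    (h : rep_hom U U') :
  rep_comp (rep_assoc V' W' U') (rep_omap (rep_omap f g) h) =
  rep_comp (rep_omap f (rep_omap g h)) (rep_assoc V W U).
Proof.
apply: rep_hom_ext => x; rewrite !rep_compE !rep_assocE !rep_omapE.
apply/esym/(etrans (@tmap_ext_act H _ V V' (ext_module W U)
  (ext_module W' U') (vsval f) (vsval (rep_omap g h)) _ _ _ _ _ _)).
- exact: linearP.
- exact: linearP.
- exact: rep_homA.
- move=> b w; rewrite !rep_omapE.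
  apply: tmap_ext_act; try exact: linearP; exact: rep_homA.
rewrite /act3; congr ext_act; move: x.
apply: tensor_ext3l => [e u v|e u v|v w u]; rewrite ?tmapP ?linearP ?tmapP //.
rewrite tassoc_pure !tmap_pure; try exact: linearP.
by rewrite !rep_omapE !tmap_pure ?tassoc_pure; try exact: linearP.
Qed.
Fact rep_lunit_nat V W (f : rep_hom V W) :
  rep_comp (rep_lunit W) (rep_omap (rep_id rep_unit) f) =
  rep_comp f (rep_lunit V).
Proof.
apply: rep_hom_ext => x; rewrite !rep_compE !rep_lunitE rep_omapE; move: x.
apply: tensor_extP => [e u v|e u v|v w]; rewrite ?tmapP ?linearP //.
rewrite tmap_pure; try exact: linearP.
by rewrite !lunit_pure linearZ rep_idE.
Qed.
Fact rep_runit_nat V W (f : rep_hom V W) :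
  rep_comp (rep_runit W) (rep_omap f (rep_id rep_unit)) =
  rep_comp f (rep_runit V).
Proof.
apply: rep_hom_ext => x; rewrite !rep_compE !rep_runitE rep_omapE; move: x.
apply: tensor_extP => [e u v|e u v|v w]; rewrite ?tmapP ?linearP //.
rewrite tmap_pure; try exact: linearP.
by rewrite !runit_pure linearZ rep_idE.
Qed.

Lemma tmap_ext_act2 (A B A' B' : falgType K) (V : module A) (V' : module A')
    (W : module B) (W' : module B') (p : A -> A') (q : B -> B')
    (f : V -> V') (g : W -> W') :
  linear p -> linear q -> linear f -> linear g ->
  (forall a v, f (act a v) = act (p a) (f v)) ->
  (forall b w, g (act b w) = act (q b) (g w)) ->
  forall t x, tmap f g (ext_act t x) = ext_act (tmap p q t) (tmap f g x).
Proof.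
move=> pl ql fl gl fA gA t x.
have [El Er] := ext_act_bilin V W; have [El' Er'] := ext_act_bilin V' W'.
move: t; apply: tensor_extP => [e u v|e u v|a b];
  rewrite ?El ?tmapP ?El' //.
move: x; apply: tensor_extP => [e u v|e u v|v w]; rewrite ?Er ?tmapP ?Er' //.
by rewrite ext_act_pure !tmap_pure // ext_act_pure fA gA.
Qed.

Lemma tmap_id (V W : vectType K) (x : tensor V W) : tmap idfun idfun x = x.
Proof. exact: tlift_id. Qed.

Fact rep_triangle V W :
  rep_comp (rep_omap (rep_id V) (rep_lunit W)) (rep_assoc V rep_unit W) =
  rep_omap (rep_runit V) (rep_id W).
Proof.
apply: rep_hom_ext => x; rewrite rep_compE !rep_omapE rep_assocE /act3.
apply: etrans (@tmap_ext_act2 H _ H H V V (ext_module rep_unit W) W idfun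
  (tlift (fun a b => (counit a : K) *: b)) (vsval (rep_id V))
  (vsval (rep_lunit W)) _ _ _ _ _ _ _ _) _; try exact: linearP; try by [].
- by move=> a v; rewrite !rep_idE.
- by move=> b w; rewrite !rep_lunitE lunit_act.
rewrite Phi_counit ext_act1; move: x.
apply: tensor_ext3l => [e u v|e u v|v w u]; rewrite ?tmapP ?linearP ?tmapP //.
rewrite tassoc_pure !tmap_pure; try exact: linearP.
rewrite !rep_idE rep_lunitE rep_runitE lunit_pure runit_pure.
by rewrite (linear_scale _ _ (pure_linl _)) (linear_scale _ _ (pure_linr _)).
Qed.

Fact rep_pentagon V W U Y :
  rep_comp (rep_assoc V W (rep_tensor U Y)) (rep_assoc (rep_tensor V W) U Y) =
  rep_comp (rep_comp (rep_omap (rep_id V) (rep_assoc W U Y))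
    (rep_assoc V (rep_tensor W U) Y)) (rep_omap (rep_assoc V W U) (rep_id Y)).
Proof.
pose M4 := ext_module V (ext_module W (ext_module U Y)).
apply: rep_hom_ext => x; rewrite !rep_compE.
have -> : vsval (rep_assoc (rep_tensor V W) U Y) x =
    @ext_act K _ _ (ext_module V W) (ext_module U Y)
      (tmap comul idfun (Phi H)) (tassoc x).
  by rewrite rep_assocE /act3 -ext_act_resl.
have AE z : vsval (rep_assoc V W (rep_tensor U Y)) z =
    @act K _ M4 (tmap idfun (tmap idfun comul) (Phi H)) (tassoc z).
  rewrite rep_assocE /act3 -[LHS]tmap_id.
  apply: etrans (@tmap_ext_act2 H _ H _ V V (ext_module W (rep_tensor U Y))
    (ext_module W (ext_module U Y)) idfun (tmap idfun comul) idfun idfun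
    _ _ _ _ _ _ _ _) _; try by []; try exact: linearP.
    by move=> t y; rewrite /= ext_act_resr.
  by rewrite tmap_id.

have A4 t (z : tensor V (tensor (tensor W U) Y)) : tmap idfun (@tassoc K W U Y)
    (@ext_act K _ _ V (ext_module (ext_module W U) Y) t z) =
    @act K _ M4 (tmap idfun (@tassoc _ _ _ _) t) (tmap idfun (@tassoc K W U Y) z).
  apply: (@tmap_ext_act2 H _ H _ V V (ext_module (ext_module W U) Y)
    (ext_module W (ext_module U Y))); try by []; try exact: linearP.
  exact: tassoc_act.
have A1 z : vsval (rep_omap (rep_assoc V W U) (rep_id Y)) z =
    @ext_act K _ _ (ext_module V (ext_module W U)) Y (pure (Phi H) 1)
      (tmap (@tassoc K V W U) idfun z).
  rewrite rep_omapE; move: z.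
  have [El Er] := ext_act_bilin (ext_module V (ext_module W U)) Y.
  apply: tensor_extP => [e u v|e u v|v w]; rewrite ?tmapP ?Er //.
  rewrite !tmap_pure; try exact: linearP; try by [].
  rewrite rep_assocE rep_idE.
  by rewrite (ext_act_pure (V := ext_module V (ext_module W U))) act1.
have A3 z : vsval (rep_omap (rep_id V) (rep_assoc W U Y)) z =
    @act K _ M4 (pure 1 (Phi H)) (tmap idfun (@tassoc K W U Y) z).
  rewrite rep_omapE; move: z.
  have [El Er] := act_bilin M4.
  apply: tensor_extP => [e u v|e u v|v w]; rewrite ?tmapP ?Er //.
  rewrite !tmap_pure; try exact: linearP; try by [].
  rewrite rep_assocE rep_idE /=.
  by rewrite (ext_act_pure (W := ext_module W (ext_module U Y))) act1.
have A2 z : vsval (rep_assoc V (rep_tensor W U) Y) z =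
    @ext_act K _ _ V (ext_module (ext_module W U) Y)
      (tmap idfun (tmap comul idfun) (Phi H)) (tassoc z).
  rewrite rep_assocE /act3 -[LHS]tmap_id.
  apply: etrans (@tmap_ext_act2 H _ H _ V V (ext_module (rep_tensor W U) Y)
    (ext_module (ext_module W U) Y) idfun (tmap comul idfun) idfun idfun
    _ _ _ _ _ _ _ _) _; try by []; try exact: linearP.
    by move=> t y; rewrite /= ext_act_resl.
  by rewrite tmap_id.
apply: (etrans (AE _)).
apply: (etrans (congr1 (@act K _ M4 _)
  (@tassoc_act _ _ _ V W (ext_module U Y) _ _))).
apply: (etrans (esym (@actM K _ M4 _ _ _))).
rewrite Phi_pentagon; apply/esym; apply: (etrans (A3 _)).
rewrite A1 A2.
rewrite A4 !actM; congr (@act K _ M4 _ (@act K _ M4 _ _)).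
apply: (etrans (congr1 (tmap idfun (@tassoc K W U Y))
  (@tassoc_act _ _ _ V (ext_module W U) Y _ _))).
apply: (etrans (A4 _ _)); congr (@act K _ M4 _ _).
exact: (tassoc_pentagon (x : tensor (tensor (tensor V W) U) Y)).
Qed.

Definition Rep : monoidal_category K :=
  @MonoidalCategory K (rep_lin_category H) rep_tensor rep_omap rep_unit
    rep_assoc rep_lunit rep_runit rep_omap_bilin rep_omap1 rep_omapM
    rep_assoc_iso rep_lunit_iso rep_runit_iso rep_assoc_nat rep_lunit_nat
    rep_runit_nat rep_pentagon rep_triangle.
End RepMonoidal.

(* Main.v *)
(** Let X be the unique simple object of C outside D. For A in D, no simple
    summand of A ⊗ X lies in D (otherwise X would be a summand of an object of
    D, by duality), so A ⊗ X is a multiple of X: the multiples of X form a module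
    category of rank one over D. Hence A |-> Hom (X, A ⊗ X) is a tensor functor to
    vector spaces, with an honest associativity constraint. The integers
    dim Hom (X, A ⊗ X) are multiplicative, so they form a positive eigenvector of
    every fusion matrix and are the Frobenius-Perron dimensions; and Tannakian
    reconstruction gives a semisimple Hopf algebra, that is, a quasi-Hopf algebra
    with trivial associator.

    The fibre functor is represented by an object P of D, so the reconstructed
    algebra is the opposite of End P. Semisimplicity is used through von Neumann
    regularity: every f has an r with f r f = f. *)
From HB Require Import structures.
From mathcomp Require Import all_boot all_order all_algebra all_field.
From mathcomp Require Import boolp reals complex.
Require Import Defs.
Set Implicit Arguments. Unset Strict Implicit. Unset Printing Implicit Defensive.
Import GRing.Theory VectorInternalTheory.
Local Open Scope ring_scope.
Local Open Scope cat_scope.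

(** Once X is unique, everything rests on End X being the scalars: this is what splits Hom (X, A ⊗
    (B ⊗ X)) into Hom (X, A ⊗ X) tensor Hom (X, B ⊗ X). One obstacle is to carry structure between C
    and D. Monomorphisms, kernels and simplicity in D are tested against fewer objects than in C,
    whereas the identity f r f = f and scalar endomorphism rings concern hom spaces only and pass to
    a full subcategory at once; so simplicity and the abelian structure of D are derived from these.
    The other is to build a Hopf algebra without computing with natural transformations. For a
    functor Hom (P, -) Yoneda turns these into elements, so that comultiplication, counit and
    antipode are read off from identities, and their laws are checked on pure tensors. The record
    [fiber] keeps exactly this data and forgets X and C. *)

Section Bilinear.
Variables (K : fieldType) (V W U : vectType K) (f : V -> W -> U).
Hypothesis fb : bilin f.

Lemma bilinDl x y w : f (x + y) w = f x w + f y w.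
Proof. by have := fb.1 w 1 x y; rewrite !scale1r. Qed.
Lemma bilinDr v x y : f v (x + y) = f v x + f v y.
Proof. by have := fb.2 v 1 x y; rewrite !scale1r. Qed.
Lemma bilinZl a x w : f (a *: x) w = a *: f x w.
Proof. exact: linear_scale (fb.1 w). Qed.
Lemma bilinZr a v x : f v (a *: x) = a *: f v x.
Proof. exact: linear_scale (fb.2 v). Qed.
Lemma bilin0l w : f 0 w = 0.
Proof. by rewrite -(scale0r 0) bilinZl scale0r. Qed.
Lemma bilin0r v : f v 0 = 0.
Proof. by rewrite -(scale0r 0) bilinZr scale0r. Qed.
Lemma bilinNl x w : f (- x) w = - f x w.
Proof. by rewrite -scaleN1r bilinZl scaleN1r. Qed.
Lemma bilinNr v x : f v (- x) = - f v x.
Proof. by rewrite -scaleN1r bilinZr scaleN1r. Qed.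
Lemma bilin_sumL (I : Type) (r : seq I) (P : pred I) (s : I -> V) w :
  f (\sum_(i <- r | P i) s i) w = \sum_(i <- r | P i) f (s i) w.
Proof. by apply: (big_morph (f^~ w)) => [x y|]; rewrite ?bilinDl ?bilin0l. Qed.
Lemma bilin_sumR (I : Type) (r : seq I) (P : pred I) (s : I -> W) v :
  f v (\sum_(i <- r | P i) s i) = \sum_(i <- r | P i) f v (s i).
Proof. by apply: (big_morph (f v)) => [x y|]; rewrite ?bilinDr ?bilin0r. Qed.
End Bilinear.

Section CompositionRules.
Variables (K : fieldType) (C : lin_category K).
Implicit Types X Y Z : C.

Lemma compDl X Y Z (f g : hom Y Z) (h : hom X Y) : (f + g) ∘ h = f ∘ h + g ∘ h.
Proof. exact: bilinDl (@comp_bilin K C _ _ _) _ _ _. Qed.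
Lemma compDr X Y Z (h : hom Y Z) (f g : hom X Y) : h ∘ (f + g) = h ∘ f + h ∘ g.
Proof. exact: bilinDr (@comp_bilin K C _ _ _) _ _ _. Qed.
Lemma compNl X Y Z (f : hom Y Z) (h : hom X Y) : (- f) ∘ h = - (f ∘ h).
Proof. exact: bilinNl (@comp_bilin K C _ _ _) _ _. Qed.
Lemma compNr X Y Z (f : hom Y Z) (h : hom X Y) : f ∘ (- h) = - (f ∘ h).
Proof. exact: bilinNr (@comp_bilin K C _ _ _) _ _. Qed.
Lemma compBl X Y Z (f g : hom Y Z) (h : hom X Y) : (f - g) ∘ h = f ∘ h - g ∘ h.
Proof. by rewrite compDl compNl. Qed.
Lemma compBr X Y Z (h : hom Y Z) (f g : hom X Y) : h ∘ (f - g) = h ∘ f - h ∘ g.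
Proof. by rewrite compDr compNr. Qed.
Lemma compZl X Y Z a (f : hom Y Z) (h : hom X Y) : (a *: f) ∘ h = a *: (f ∘ h).
Proof. exact: bilinZl (@comp_bilin K C _ _ _) _ _ _. Qed.
Lemma compZr X Y Z a (f : hom Y Z) (h : hom X Y) : f ∘ (a *: h) = a *: (f ∘ h).
Proof. exact: bilinZr (@comp_bilin K C _ _ _) _ _ _. Qed.
Lemma comp0l X Y Z (h : hom X Y) : (0 : hom Y Z) ∘ h = 0.
Proof. exact: bilin0l (@comp_bilin K C _ _ _) _. Qed.
Lemma comp0r X Y Z (h : hom Y Z) : h ∘ (0 : hom X Y) = 0.
Proof. exact: bilin0r (@comp_bilin K C _ _ _) _. Qed.
Lemma comp_suml X Y Z (I : Type) (r : seq I) (P : pred I) (s : I -> hom Y Z)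
  (h : hom X Y) : (\sum_(i <- r | P i) s i) ∘ h = \sum_(i <- r | P i) s i ∘ h.
Proof. by rewrite (bilin_sumL (@comp_bilin K C X Y Z)). Qed.
Lemma comp_sumr X Y Z (I : Type) (r : seq I) (P : pred I) (s : I -> hom X Y)
  (h : hom Y Z) : h ∘ (\sum_(i <- r | P i) s i) = \sum_(i <- r | P i) h ∘ s i.
Proof. by rewrite (bilin_sumR (@comp_bilin K C X Y Z)). Qed.

End CompositionRules.

(** * Von Neumann regular linear categories *)

Section RegularCategories.
Variables (K : fieldType) (C : lin_category K).
Implicit Types X Y Z : C.

Definition regular_homs := forall X Y (f : hom X Y),
  exists r : hom Y X, f ∘ r ∘ f = f.

Definition split_idempotents := forall X (e : hom X X), e ∘ e = e ->
  exists A (i : hom A X) (p : hom X A), p ∘ i = idm A /\ i ∘ p = e.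

Definition has_sums := forall n (S : 'I_n -> C), exists X, direct_sum S X.

(* Unlike [simple_object], this is visibly inherited by full subcategories. *)
Definition scalar_simple X :=
  idm X != 0 /\ forall f : hom X X, exists c, f = c *: idm X.

Lemma idm0_zero X : idm X = 0 -> zero_object X.
Proof.
move=> z Y; split=> f; first by rewrite -[f]compm1 z comp0r.
by rewrite -[f]comp1m z comp0l.
Qed.

Lemma zero_idm0 X : zero_object X -> idm X = 0.
Proof. by case/(_ X). Qed.

Lemma simple_idm_neq0 X : simple_object X -> idm X != 0.
Proof. by case=> nz _; apply/eqP => /idm0_zero. Qed.

(** A regular inverse r of a mono f is a left inverse, and f r is a scalar c with c f = f; so either
    f = 0 and its source is zero, or c = 1 and r is the inverse. *)
Lemma simple_scalar : regular_homs -> forall X, scalar_simple X -> simple_object X.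
Proof.
move=> reg X [nz sc]; split=> [/zero_idm0/eqP|Y f fm]; first by apply/negP.
have [r frf] := reg _ _ f.
have rf : r ∘ f = idm Y by apply: fm; rewrite compA frf compm1.
have [c fr] := sc (f ∘ r).
have cf : c *: f = f by rewrite -{2}frf fr compZl comp1m.
have [f0|fn0] := eqVneq f 0.
  by left; apply: idm0_zero; rewrite -rf f0 comp0r.
right; exists r; split=> //; rewrite fr.
have /eqP := cf; rewrite -subr_eq0 -{2}[f]scale1r -scalerBl scaler_eq0.
by rewrite (negPf fn0) orbF subr_eq0 => /eqP->; rewrite scale1r.
Qed.

Section ScalarHoms.
Hypothesis reg : regular_homs.

Lemma scalar_retract X Y (f : hom Y X) : scalar_simple X -> f != 0 ->
  exists g, f ∘ g = idm X.
Proof.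
move=> [nz sc] f0; have [r frf] := reg f; have [c fr] := sc (f ∘ r).
exists r; rewrite fr.
have /eqP : c *: f = f by rewrite -{2}frf fr compZl comp1m.
rewrite -subr_eq0 -{2}[f]scale1r -scalerBl scaler_eq0.
by rewrite (negPf f0) orbF subr_eq0 => /eqP->; rewrite scale1r.
Qed.

End ScalarHoms.

Lemma isomorphic_sym X Y : isomorphic X Y -> isomorphic Y X.
Proof. by case=> f [g [gf fg]]; exists g, f. Qed.

Lemma isomorphic_trans X Y Z : isomorphic X Y -> isomorphic Y Z -> isomorphic X Z.
Proof.
move=> [f [f' [f'f ff']]] [g [g' [g'g gg']]]; exists (g ∘ f), (f' ∘ g'); split.
  by rewrite compA -(compA f') g'g compm1 f'f.
by rewrite compA -(compA g) ff' compm1 gg'.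
Qed.

Section Abelian.
Hypotheses (reg : regular_homs) (spl : split_idempotents) (sums : has_sums).

Lemma idm_sub_idem X (e : hom X X) : e ∘ e = e ->
  (idm X - e) ∘ (idm X - e) = idm X - e.
Proof. by move=> ee; rewrite compBl comp1m compBr compm1 ee subrr subr0. Qed.

(** If f r f = f, then r f and f r are idempotents. Splitting id - r f gives a kernel, splitting id
    - f r a cokernel, and every mono or epi is split. *)
Lemma regular_abelian : abelian C.
Proof.
split=> //.
- move=> X Y f; have [r frf] := reg f.
  have ee : r ∘ f ∘ (r ∘ f) = r ∘ f by rewrite compA -!(compA r) frf.
  have [A [i [p [pi ip]]]] := spl (idm_sub_idem ee).
  exists A, i; split.
    rewrite -[ i]compm1 -pi (compA i) ip compA compBr compm1 compA frf subrr.
    by rewrite comp0l.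
  move=> Z g fg; exists (p ∘ g); split.
    by rewrite compA ip compBl comp1m -compA fg comp0r subr0.
  by move=> h <-; rewrite compA pi comp1m.
- move=> X Y f; have [r frf] := reg f.
  have ee : f ∘ r ∘ (f ∘ r) = f ∘ r by rewrite compA frf.
  have [A [i [p [pi ip]]]] := spl (idm_sub_idem ee).
  exists A, p; split.
    rewrite -[p]comp1m -pi -(compA p) ip -compA compBl comp1m frf subrr.
    by rewrite comp0r.
  move=> Z g gf; exists (g ∘ i); split.
    by rewrite -compA ip compBr compm1 compA gf comp0l subr0.
  by move=> h <-; rewrite -compA pi compm1.
- move=> X Y f fm; have [r frf] := reg f.
  have rf : r ∘ f = idm X by apply: fm; rewrite compA frf compm1.
  exists Y, (idm Y - f ∘ r); split; first by rewrite compBl comp1m frf subrr.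
  move=> Z g /eqP; rewrite compBl comp1m subr_eq0 => /eqP gE.
  exists (r ∘ g); split; first by rewrite compA -gE.
  by move=> h <-; rewrite compA rf comp1m.
- move=> X Y f fe; have [r frf] := reg f.
  have fr : f ∘ r = idm Y by apply: fe; rewrite frf comp1m.
  exists X, (idm X - r ∘ f); split.
    by rewrite compBr compm1 compA frf subrr.
  move=> Z g /eqP; rewrite compBr compm1 subr_eq0 => /eqP gE.
  exists (g ∘ r); split; first by rewrite -compA -gE.
  by move=> h <-; rewrite -compA fr compm1.
Qed.
End Abelian.

Section Semisimple.
Hypothesis ss : semisimple C.

Lemma semisimple_sums : has_sums.
Proof. by case: ss => -[]. Qed.

(** The image of e is obtained as the kernel of id - e. *)
Lemma semisimple_split : split_idempotents.
Proof.
case: ss => -[_ ker _ _ _] _ X e ee.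
have [A [k [k0 ku]]] := ker _ _ (idm X - e).
have ek : e ∘ k = k.
  by apply/eqP; rewrite eq_sym -subr_eq0 -{1}[k]comp1m -compBl k0.
have /ku [p [kp _]] : (idm X - e) ∘ e = 0 by rewrite compBl comp1m ee subrr.
exists A, k, p; split=> //.
(* Both [p ∘ k] and the identity factor [k] through itself, so the uniqueness clause of the kernel
   identifies them. *)
have [h [_ hu]] := ku _ k k0.
by rewrite -(hu (p ∘ k)) ?compA ?kp // (hu (idm A)) ?compm1.
Qed.

(** First half of Schur's lemma: the kernel of f is zero or all of X; the latter would give f = 0,
    so f is a mono into a simple object. *)
Lemma simple_hom_iso X Y (f : hom X Y) :
  simple_object X -> simple_object Y -> f != 0 -> is_iso f.
Proof.
case: ss => -[_ ker _ _ _] _ [Xnz Xs] [_ Ys] f0.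
have [A [k [fk ku]]] := ker _ _ f.
have km : is_mono k.
  move=> Z g h gh; have [w [_ wu]] := ku _ (k ∘ g) (etrans (compA _ _ _)
    (etrans (congr1 (fun z => z ∘ g) fk) (comp0l _ _))).
  by rewrite -(wu g) // -(wu h).
have [Az|[k' [k'k kk']]] := Xs _ _ km; last first.
  by case/eqP: f0; rewrite -[f]compm1 -kk' compA fk comp0l.
suff fm : is_mono f by have [/Xnz|] := Ys _ _ fm.
move=> Z g h gh; have /ku [w [kw _]] : f ∘ (g - h) = 0 by rewrite compBr gh subrr.
by apply/eqP; rewrite -subr_eq0 -kw (proj2 (Az Z) w) comp0r.
Qed.

(* McCoy's lemma. *)
Lemma regular_outer_inverse X Y (f : hom X Y) (s : hom Y X) :
  (exists r, (f - f ∘ s ∘ f) ∘ r ∘ (f - f ∘ s ∘ f) = f - f ∘ s ∘ f) ->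
  exists r, f ∘ r ∘ f = f.
Proof.
case=> r rE; exists (s + (idm X - s ∘ f) ∘ r ∘ (idm Y - f ∘ s)).
have L : f ∘ (idm X - s ∘ f) = f - f ∘ s ∘ f by rewrite compBr compm1 compA.
have R : (idm Y - f ∘ s) ∘ f = f - f ∘ s ∘ f by rewrite compBl comp1m.
by rewrite compDr compDl !(compA f) L -(compA _ (idm Y - f ∘ s)) R rE addrC subrK.
Qed.

(** Induction on the dimension of the space of all g ∘ f, which plays the role of the rank of f. A
    nonzero entry of f between simple summands is invertible by Schur; inverting it gives an s for
    which f - f s f has smaller rank, and McCoy's lemma lifts an inner inverse back to f. *)
Lemma semisimple_regular : regular_homs.
Proof.
case: (ss) => _ dec X Y.
have [n [S [Ss [inj [proj [pi _ sumX]]]]]] := dec X.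
have [m [T [Ts [inj' [proj' [_ _ sumY]]]]]] := dec Y.
pose pre (f : hom X Y) := linfun (fun g : hom Y X => g ∘ f).
have preE f g : pre f g = g ∘ f.
  pose h := HB.pack_for {linear hom Y X -> hom X X} (fun g : hom Y X => g ∘ f)
    (GRing.isLinear.Build K _ _ _ _ ((@comp_bilin K C X Y X).1 f)).
  exact: (lfunE h).
move=> f; have [k] := ubnP (\dim (limg (pre f))); elim: k f => // k IH f.
rewrite ltnS => fk.
have [f0|fn0] := eqVneq f 0; first by exists 0; rewrite f0 !comp0l.
have [i [j ij]] : exists i j, proj' j ∘ f ∘ inj i != 0.
  apply: contrapT => no; case/eqP: fn0.
  rewrite -[f]compm1 -[f]comp1m -sumX -sumY !comp_suml big1 // => j _.
  rewrite comp_sumr big1 // => i _.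
  have E : proj' j ∘ f ∘ inj i = 0.
    by apply/eqP; apply: contrapT => h; apply: no; exists i, j; apply/negP.
  by rewrite compA -(compA (inj' j)) -(compA (inj' j)) E comp0r comp0l.
have [u [u1 _]] := simple_hom_iso (Ss i) (Ts j) ij.
pose s := inj i ∘ u ∘ proj' j.
have sfi : s ∘ f ∘ inj i = inj i.
  by rewrite /s -!compA (compA (proj' j)) u1 compm1.
have sfs : s ∘ f ∘ s = s by rewrite {2}/s !compA sfi.
apply: (@regular_outer_inverse _ _ f s); apply: IH.
set f' := f - _; apply: leq_trans fk.
have sub : (limg (pre f') <= limg (pre f))%VS.
  apply/subvP=> _ /memv_imgP[g _ ->]; rewrite preE.
  apply/memv_imgP; exists (g ∘ (idm Y - f ∘ s)); first exact: memvf.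
  by rewrite preE -compA compBl comp1m.
have sf : s ∘ f \in limg (pre f) by rewrite -preE memv_img ?memvf.
rewrite ltn_neqAle (dimvS sub) andbT; apply/negP => /eqP eq.
have /eqP EV : limg (pre f') == limg (pre f) by rewrite eqEdim sub eq /=.
move: sf; rewrite -EV => /memv_imgP[g _]; rewrite preE => sfg.
(* The rank drops strictly: f' kills the summand S i while s f is the identity on it, so s f is not
   of the form g ∘ f'. *)
have f'i : f' ∘ inj i = 0.
  by rewrite /f' compBl -(compA f) -(compA f) sfi subrr.
have /eqP[] := simple_idm_neq0 (Ss i).
by rewrite -(pi i) -sfi sfg -(compA g) f'i !comp0r.
Qed.
End Semisimple.
End RegularCategories.

(** * Linear maps given by plain functions *)

Section LinearMaps.
Variables (K : fieldType) (V W : vectType K).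

Definition lin_pack (f : V -> W) (fl : linear f) : {linear V -> W} :=
  HB.pack_for {linear V -> W} f (GRing.isLinear.Build K V W _ f fl).

Lemma lin_packE f (fl : linear f) v : linfun (lin_pack fl) v = f v.
Proof. exact: lfunE. Qed.

Lemma linear_sumE (f : V -> W) (I : Type) (r : seq I) (P : pred I) (s : I -> V) :
  linear f -> f (\sum_(i <- r | P i) s i) = \sum_(i <- r | P i) f (s i).
Proof. by move=> fl; rewrite -[f]/(lin_pack fl : V -> W) linear_sum. Qed.

Lemma linear_0E (f : V -> W) : linear f -> f 0 = 0.
Proof. by move=> fl; rewrite -(scale0r 0) linear_scale // scale0r. Qed.

Lemma linear_inj0 (f : V -> W) : linear f -> (forall v, f v = 0 -> v = 0) ->
  injective f.
Proof.
move=> fl f0 x y fxy; apply/eqP; rewrite -subr_eq0; apply/eqP/f0.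
by rewrite addrC -scaleN1r fl fxy scaleN1r addNr.
Qed.

Lemma linear_cancel (f : V -> W) g : linear f -> cancel f g -> cancel g f ->
  linear g.
Proof. by move=> fl fK gK a x y; apply: (can_inj fK); rewrite fl !gK. Qed.

Lemma linear_dim (f : V -> W) g : linear f -> cancel f g -> cancel g f ->
  \dim {: V} = \dim {: W}.
Proof.
move=> fl fK gK; rewrite -(@limg_dim_eq _ _ _ (linfun (lin_pack fl)) fullv).
  congr (\dim _); apply/eqP; rewrite eqEsubv subvf; apply/subvP=> w _.
  by apply/memv_imgP; exists (g w); rewrite ?memvf // lin_packE gK.
suff /eqP-> : lker (linfun (lin_pack fl)) == 0%VS by rewrite capv0.
by apply/lker0P => x y; rewrite !lin_packE; apply: can_inj fK _ _.
Qed.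
End LinearMaps.

Lemma linear_inj_bij (K : fieldType) (V : vectType K) (f : V -> V) :
  linear f -> injective f -> bijective f.
Proof.
move=> fl fi; have k0 : lker (linfun (lin_pack fl)) == 0%VS.
  by apply/lker0P => x y; rewrite !lin_packE; apply: fi.
exists (linfun (lin_pack fl))^-1%VF => x.
  by rewrite -{2}(lker0_lfunK k0 x) lin_packE.
by rewrite -[LHS](lin_packE fl) lker0_lfunVK.
Qed.

(** * Schur's lemma over an algebraically closed field *)

Section Schur.
Variables (K : closedFieldType).

Lemma exists_eigenvector (V : vectType K) (f : 'End(V)) :
  fullv != 0%VS :> {vspace V} -> exists c v, v != 0 /\ f v = c *: v.
Proof.
move=> V0; pose A := f2mx f.
have n0 : (0 < \dim {: V})%N by rewrite lt0n dimv_eq0.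
have [c cA] : exists c, eigenvalue A c.
  have /closed_rootP[c rc] : size (char_poly A) != 1.
    by rewrite size_char_poly eqSS -lt0n -dimvf.
  by exists c; rewrite eigenvalue_root_char.
have [v vA v0] := eigenvalueP cA.
exists c, (r2v v); split.
  apply: contra v0 => /eqP E.
  by rewrite -(r2vK v) E linear0.
rewrite unlock /fun_of_lfun_def /= r2vK.
by rewrite -linearZ -vA.
Qed.

(** Composition with f on the finite-dimensional space End X has an eigenvector g of some eigenvalue
    c; then f - c kills g ≠ 0, so it is not invertible and must vanish. *)
Lemma schur (C : lin_category K) (X : C) :
  semisimple C -> simple_object X -> scalar_simple X.
Proof.
move=> ss Xs; have X1 := simple_idm_neq0 Xs; split=> // f.
pose L := linfun (lin_pack ((@comp_bilin K C X X X).2 f)).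
have /(exists_eigenvector L)[c [g [g0 fg]]] : fullv != 0%VS :> {vspace hom X X}.
  by apply/eqP=> E; move: X1; rewrite -memv0 -E memvf.
exists c; apply/eqP; rewrite -subr_eq0; apply: contraT => d0.
have [u [uh _]] := simple_hom_iso ss Xs Xs d0.
case/eqP: g0; rewrite -[g]comp1m -uh -compA compBl compZl comp1m.
by move: fg; rewrite lin_packE => ->; rewrite subrr comp0r.
Qed.
End Schur.

Section MonoidalRules.
Variables (K : fieldType) (C : monoidal_category K).
Implicit Types X Y Z : C.

Lemma omap0r X X' Y Y' (f : hom X X') : f ⊗m (0 : hom Y Y') = 0.
Proof. exact: bilin0r (@omap_bilin K C _ _ _ _) _. Qed.
Lemma omapZl X X' Y Y' a (f : hom X X') (g : hom Y Y') :
  (a *: f) ⊗m g = a *: (f ⊗m g).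
Proof. exact: bilinZl (@omap_bilin K C _ _ _ _) _ _ _. Qed.
Lemma omapZr X X' Y Y' a (f : hom X X') (g : hom Y Y') :
  f ⊗m (a *: g) = a *: (f ⊗m g).
Proof. exact: bilinZr (@omap_bilin K C _ _ _ _) _ _ _. Qed.
Lemma omap_sumr X X' Y Y' (I : Type) (r : seq I) (P : pred I)
  (s : I -> hom Y Y') (f : hom X X') :
  f ⊗m (\sum_(i <- r | P i) s i) = \sum_(i <- r | P i) f ⊗m s i.
Proof. by rewrite (bilin_sumR (@omap_bilin K C X X' Y Y')). Qed.

Lemma omap_interchange X X' Y Y' (f : hom X X') (g : hom Y Y') :
  (f ⊗m idm Y') ∘ (idm X ⊗m g) = (idm X' ⊗m g) ∘ (f ⊗m idm Y).
Proof. by rewrite -!omapM !comp1m !compm1. Qed.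

End MonoidalRules.

(** * Full subcategories *)

Section Subcategory.
Variables (K : closedFieldType) (C : monoidal_category K).
Variable D : fusion_subcategory C.
Hypothesis ssC : semisimple C.

Lemma sub_regular : regular_homs D.
Proof. by move=> X Y f; apply: (semisimple_regular ssC f). Qed.

Lemma sub_split : split_idempotents D.
Proof.
move=> X e ee; have [A [i [p [pi ip]]]] := semisimple_split ssC ee.
by exists (exist _ A (sub_retract pi (svalP X))), i, p.
Qed.

Lemma sub_sums : has_sums D.
Proof.
move=> n S; have [X SX] := semisimple_sums ssC (fun i => sval (S i)).
by exists (exist _ X (sub_direct_sum (fun i => svalP (S i)) SX)).
Qed.

(** The passage goes through scalar endomorphisms, because a mono of D is only tested on objects of
    D and need not visibly be a mono of C. *)
Lemma sub_simple (X : D) : simple_object (sval X) -> simple_object X.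
Proof.
by move=> Xs; apply: (simple_scalar sub_regular (schur ssC Xs)).
Qed.

Lemma sub_semisimple : semisimple D.
Proof.
split; first exact: regular_abelian sub_regular sub_split sub_sums.
move=> X; have [n [S [Ss SX]]] := ssC.2 (sval X).
have SD i : D (S i).
  by case: SX => inj [proj [pi _ _]]; apply: sub_retract (pi i) (svalP X).
exists n, (fun i => exist _ (S i) (SD i)); split=> // i.
exact: (@sub_simple (exist _ (S i) (SD i)) (Ss i)).
Qed.

Lemma simple_sub (X : D) : simple_object X -> simple_object (sval X).
Proof.
move=> Xs; apply: (simple_scalar (semisimple_regular ssC)).
exact: (schur sub_semisimple Xs).
Qed.

Lemma sub_rigid : rigid C -> rigid D.
Proof.
move=> rg X; case: (rg (sval X)) => -[Y XY] [Z ZX]; split.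
  exists (exist _ Y (sub_left_dual XY (svalP X))); exact: XY.
exists (exist _ Z (sub_right_dual ZX (svalP X))); exact: ZX.
Qed.
End Subcategory.

(** * Reconstruction from a represented fibre functor *)

(* The functor [A |-> hom gen A] with its tensor structure [conv], whose unit
   isomorphism sends 1 to [eps]; [gen_cover] says that [gen] is a generator. *)
Record fiber (K : fieldType) (D : monoidal_category K) := Fiber {
  gen : D;
  conv : forall A B : D, hom gen A -> hom gen B -> hom gen (A ⊗ B);
  eps : hom gen 𝟙;
  conv_bilin : forall A B, bilin (@conv A B);
  conv_nat : forall (A A' B B' : D) (u : hom A A') (v : hom B B')
    (f : hom gen A) (g : hom gen B),
    conv (u ∘ f) (v ∘ g) = (u ⊗m v) ∘ conv f g;
  conv_assoc : forall (A B E : D) (f : hom gen A) (g : hom gen B) (h : hom gen E),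
    assoc A B E ∘ conv (conv f g) h = conv f (conv g h);
  conv_lunit : forall (A : D) (f : hom gen A), lunit A ∘ conv eps f = f;
  conv_runit : forall (A : D) (f : hom gen A), runit A ∘ conv f eps = f;
  conv_bij : forall A B : D, bijective (tlift (@conv A B));
  eps_span : forall f : hom gen 𝟙, exists c, f = c *: eps;
  gen_neq0 : idm gen != 0;
  gen_cover : forall A : D, exists n (i : 'I_n -> hom gen A) (p : 'I_n -> hom A gen),
    \sum_k i k ∘ p k = idm A
}.

Arguments conv {K D} w {A B} f g : rename.
Arguments eps {K D} w : rename.

Section EndAlgebra.
Variables (K : fieldType) (D : monoidal_category K).

Definition endop (w : fiber D) : Type := hom (gen w) (gen w).
Variable w : fiber D.
HB.instance Definition _ := Vector.copy (endop w) (hom (gen w) (gen w)).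

(* The opposite of composition, so that precomposition is a left action. *)
Definition emul (h k : endop w) : endop w := k ∘ h.
Fact emulA : associative emul. Proof. by move=> x y z; rewrite /emul compA. Qed.
Fact emul1l : left_id (idm (gen w) : endop w) emul.
Proof. by move=> x; rewrite /emul compm1. Qed.
Fact emul1r : right_id (idm (gen w) : endop w) emul.
Proof. by move=> x; rewrite /emul comp1m. Qed.
Fact emulDl : left_distributive emul +%R.
Proof. by move=> x y z; rewrite /emul compDr. Qed.
Fact emulDr : right_distributive emul +%R.
Proof. by move=> x y z; rewrite /emul compDl. Qed.
HB.instance Definition _ := GRing.Zmodule_isNzRing.Build (endop w)
  emulA emul1l emul1r emulDl emulDr (gen_neq0 w).
Fact escalerAl (a : K) (x y : endop w) : a *: (x * y) = (a *: x) * y.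
Proof. by rewrite -[LHS]compZr. Qed.
HB.instance Definition _ := GRing.Lmodule_isLalgebra.Build K (endop w) escalerAl.
Fact escalerAr (a : K) (x y : endop w) : a *: (x * y) = x * (a *: y).
Proof. by rewrite -[LHS]compZl. Qed.
HB.instance Definition _ := GRing.Lalgebra_isAlgebra.Build K (endop w) escalerAr.
HB.instance Definition _ := Algebra_isFalgebra.Build K (endop w).
End EndAlgebra.

Section Tlift.
Variables (K : fieldType) (V W : vectType K).

Lemma tlift_comp (U Z : vectType K) (g : U -> Z) (f : V -> W -> U) t :
  linear g -> g (tlift f t) = tlift (fun v w => g (f v w)) t.
Proof.
move=> gl; rewrite /tlift (linear_sumE _ _ _ gl); apply: eq_bigr => i _.
rewrite (linear_sumE _ _ _ gl); apply: eq_bigr => j _.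
exact: linear_scale.
Qed.

Lemma eq_tlift (U : vectType K) (f g : V -> W -> U) t :
  (forall v w, f v w = g v w) -> tlift f t = tlift g t.
Proof.
by move=> fg; apply: eq_bigr => i _; apply: eq_bigr => j _; rewrite fg.
Qed.

Lemma tlift_eq (U : vectType K) (f : V -> W -> U) (g : tensor V W -> U) :
  bilin f -> linear g -> (forall v w, f v w = g (pure v w)) -> tlift f =1 g.
Proof.
move=> fb gl fg; apply: tensor_extP => // [|v w]; first exact: tlift_is_linear.
by rewrite tlift_pure.
Qed.
End Tlift.

(** * The bialgebra of endomorphisms of the generator *)

Section Reconstruction.
Variables (K : fieldType) (D : monoidal_category K) (w : fiber D).
Local Notation P := (gen w).
Local Notation F A := (hom P A).
Local Notation H := (endop w).
Local Notation "f ⋆ g" := (conv w f g) (at level 40, left associativity).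
Local Notation eps := (eps w).
Implicit Types A B : D.

Lemma conv_compl A A' B (u : hom A A') (f : F A) (g : F B) :
  (u ∘ f) ⋆ g = (u ⊗m idm B) ∘ (f ⋆ g).
Proof. by rewrite -conv_nat comp1m. Qed.
Lemma conv_compr A B B' (v : hom B B') (f : F A) (g : F B) :
  f ⋆ (v ∘ g) = (idm A ⊗m v) ∘ (f ⋆ g).
Proof. by rewrite -conv_nat comp1m. Qed.
Lemma convZl A B a (f : F A) (g : F B) : (a *: f) ⋆ g = a *: (f ⋆ g).
Proof. exact: bilinZl (@conv_bilin K D w A B) _ _ _. Qed.
Lemma convZr A B a (f : F A) (g : F B) : f ⋆ (a *: g) = a *: (f ⋆ g).
Proof. exact: bilinZr (@conv_bilin K D w A B) _ _ _. Qed.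
Lemma conv_linl A B (g : F B) : linear (fun f : F A => f ⋆ g).
Proof. exact: (@conv_bilin K D w A B).1. Qed.
Lemma conv_linr A B (f : F A) : linear (fun g : F B => f ⋆ g).
Proof. exact: (@conv_bilin K D w A B).2. Qed.
Lemma comp_linl (X Y Z : D) (h : hom X Y) : linear (fun f : hom Y Z => f ∘ h).
Proof. exact: (@comp_bilin K D X Y Z).1. Qed.
Lemma comp_linr (X Y Z : D) (h : hom Y Z) : linear (fun f : hom X Y => h ∘ f).
Proof. exact: (@comp_bilin K D X Y Z).2. Qed.

Definition joint A B : tensor (F A) (F B) -> F (A ⊗ B) :=
  tlift (fun f g => f ⋆ g).

Lemma joint_linear A B : linear (@joint A B).
Proof. exact: tlift_is_linear. Qed.

Lemma joint_pure A B (f : F A) (g : F B) : joint (pure f g) = f ⋆ g.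
Proof. exact: tlift_pure (@conv_bilin K D w A B). Qed.

Lemma joint_inj A B : injective (@joint A B).
Proof. exact: bij_inj (@conv_bij K D w A B). Qed.

(** Inverting through [linfun] makes the inverse linear by construction, whereas [conv_bij] only
    provides a function. *)
Definition unjoint A B : F (A ⊗ B) -> tensor (F A) (F B) :=
  (linfun (lin_pack (@joint_linear A B)))^-1%VF.

Lemma unjoint_linear A B : linear (@unjoint A B).
Proof. exact: linearP. Qed.

Lemma jointK A B : cancel (@joint A B) (@unjoint A B).
Proof.
move=> t; rewrite -[X in unjoint X](lin_packE (@joint_linear A B)).
apply: lker0_lfunK; apply/lker0P => x y; rewrite !lin_packE.
exact: joint_inj.
Qed.

Lemma unjointK A B : cancel (@unjoint A B) (@joint A B).
Proof.
have [g _ gK] := @conv_bij K D w A B.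
by move=> f; rewrite -[f]gK -/(joint _) jointK.
Qed.

Fact eps_coord_subproof (f : F 𝟙) : exists c : K, f = c *: eps.
Proof. exact: eps_span. Qed.
Definition eps_coord (f : F 𝟙) : K := sval (cid (eps_coord_subproof f)).
Lemma eps_coordE (f : F 𝟙) : f = eps_coord f *: eps.
Proof. exact: svalP (cid (eps_coord_subproof f)). Qed.

Lemma eps_neq0 : eps != 0.
Proof.
apply: contra (gen_neq0 w) => /eqP E.
rewrite -[idm P]conv_lunit E (bilin0l (@conv_bilin K D w _ _)) comp0r //.
Qed.

Lemma eps_coordZ c : eps_coord (c *: eps) = c.
Proof.
apply/eqP; have /eqP := eps_coordE (c *: eps).
rewrite -subr_eq0 -scalerBl scaler_eq0 (negPf eps_neq0) orbF subr_eq0.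
by rewrite eq_sym.
Qed.

Lemma eps_coord_linear : linear (eps_coord : F 𝟙 -> K^o).
Proof.
by move=> a f g; rewrite {1}(eps_coordE f) {1}(eps_coordE g) scalerA -scalerDl
  eps_coordZ.
Qed.

Lemma eps_coord_eps : eps_coord eps = 1.
Proof. by rewrite -[eps]scale1r eps_coordZ. Qed.

Definition fmod_act A (h : H) (f : F A) : F A := f ∘ h.
Fact fmod_act_bilin A : bilin (@fmod_act A).
Proof. by split=> [f|h] a x y; [apply: comp_linr|apply: comp_linl]. Qed.
Fact fmod_act1 A (f : F A) : fmod_act 1 f = f.
Proof. exact: compm1. Qed.
Fact fmod_actM A (h k : H) (f : F A) : fmod_act (h * k) f = fmod_act h (fmod_act k f).
Proof. exact: compA. Qed.
Definition fmod A : module H :=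
  Module (@fmod_act_bilin A) (@fmod_act1 A) (@fmod_actM A).

(** The universal element of the tensor structure: together with [eps] it makes P a comonoid in D,
    from which [conv] is recovered by Yoneda. *)
Definition delta : F (P ⊗ P) := (idm P) ⋆ (idm P).

Lemma conv_delta A B (f : F A) (g : F B) : f ⋆ g = (f ⊗m g) ∘ delta.
Proof. by rewrite -conv_nat !compm1. Qed.

Lemma joint_act_pure A B (t : tensor H H) (f : F A) (g : F B) :
  joint (@ext_act K H H (fmod A) (fmod B) t (pure f g)) = (f ⊗m g) ∘ joint t.
Proof.
have [El _] := ext_act_bilin (fmod A) (fmod B).
move: t; apply: tensor_extP => [a x y|a x y|h k].
- by rewrite El joint_linear.
- by rewrite joint_linear comp_linr.
- by rewrite (ext_act_pure (V := fmod A) (W := fmod B)) !joint_pure conv_nat.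
Qed.

(** Precomposition with h acts on F (P ⊗ P), which is H ⊗ H; the comultiplication records the image
    of 1 ⊗ 1. *)
Definition fcomul (h : H) : tensor H H := unjoint (delta ∘ h).

Lemma fcomul_linear : linear fcomul.
Proof. by move=> a x y; rewrite /fcomul comp_linr unjoint_linear. Qed.

Lemma joint_fcomul h : joint (fcomul h) = delta ∘ h.
Proof. exact: unjointK. Qed.

(** This says that [joint] is H-linear when H acts on the tensor product through [fcomul]; it later
    gives the tensor structure of the functor to modules. *)
Lemma joint_act A B (h : H) (s : tensor (F A) (F B)) :
  joint (@ext_act K H H (fmod A) (fmod B) (fcomul h) s) = joint s ∘ h.
Proof.
have [_ Er] := ext_act_bilin (fmod A) (fmod B).
move: s; apply: tensor_extP => [a x y|a x y|f g].
- by rewrite Er joint_linear.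
- by rewrite joint_linear comp_linl.
- by rewrite joint_act_pure joint_fcomul joint_pure conv_delta compA.
Qed.

Fact fcomul_multiplicative : monoid_morphism fcomul.
Proof.
split=> [|h k]; apply: (@joint_inj P P); rewrite joint_fcomul.
  by rewrite [RHS]joint_pure compm1.
(* The product in H ⊗ H is its action on the tensor product of two regular modules, so
   multiplicativity is [joint_act] at the tensor [fcomul k]. *)
by rewrite [RHS](@joint_act P P h (fcomul k)) joint_fcomul -compA.
Qed.
HB.instance Definition _ := GRing.isLinear.Build K H (tensor H H) _
  fcomul fcomul_linear.
HB.instance Definition _ := GRing.isMonoidMorphism.Build H (tensor H H)
  fcomul fcomul_multiplicative.

Definition fcounit (h : H) : K^o := eps_coord (eps ∘ h).

Fact fcounit_linear : linear fcounit.
Proof. by move=> a x y; rewrite /fcounit comp_linr eps_coord_linear. Qed.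

Lemma eps_comp (h : H) : eps ∘ h = fcounit h *: eps.
Proof. exact: eps_coordE. Qed.

Fact fcounit_multiplicative : monoid_morphism fcounit.
Proof.
split=> [|h k]; first by rewrite /fcounit compm1 eps_coord_eps.
rewrite {1}/fcounit -[h * k]/(k ∘ h) compA eps_comp compZl eps_comp scalerA eps_coordZ.
by rewrite mulrC.
Qed.
HB.instance Definition _ := GRing.isLinear.Build K H K^o _ fcounit fcounit_linear.
HB.instance Definition _ := GRing.isMonoidMorphism.Build H K^o
  fcounit fcounit_multiplicative.

Lemma tlift_counit (t : tensor H H) :
  tlift (fun a b => fcounit a *: b) t = lunit P ∘ (eps ⊗m idm P) ∘ joint t.
Proof.
move: t; apply: tlift_eq => [|a x y|h k].
- split=> [k|h] a x y; first by rewrite fcounit_linear scalerDl scalerA.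
  by rewrite scalerDr !scalerA mulrC.
- by rewrite joint_linear comp_linr.
- rewrite joint_pure -compA -conv_nat comp1m eps_comp convZl compZr.
  by rewrite conv_lunit.
Qed.

Lemma tlift_counitr (t : tensor H H) :
  tlift (fun a b => fcounit b *: a) t = runit P ∘ (idm P ⊗m eps) ∘ joint t.
Proof.
move: t; apply: tlift_eq => [|a x y|h k].
- split=> [k|h] a x y; last by rewrite fcounit_linear scalerDl scalerA.
  by rewrite scalerDr !scalerA mulrC.
- by rewrite joint_linear comp_linr.
- rewrite joint_pure -compA -conv_nat comp1m eps_comp convZr compZr.
  by rewrite conv_runit.
Qed.

Fact fcomul_counitl h : tlift (fun a b => fcounit a *: b) (fcomul h) = h.
Proof.
rewrite tlift_counit joint_fcomul -!compA (compA _ delta) -conv_delta compA.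
by rewrite conv_lunit comp1m.
Qed.

Fact fcomul_counitr h : tlift (fun a b => fcounit b *: a) (fcomul h) = h.
Proof.
rewrite tlift_counitr joint_fcomul -!compA (compA _ delta) -conv_delta compA.
by rewrite conv_runit comp1m.
Qed.

Definition joint3 A B E (s : tensor (F A) (tensor (F B) (F E))) :
  F (A ⊗ (B ⊗ E)) := joint (tmap idfun (@joint B E) s).

Lemma joint3_linear A B E : linear (@joint3 A B E).
Proof. by move=> a x y; rewrite /joint3 tmapP joint_linear. Qed.

Lemma joint3_inj A B E : injective (@joint3 A B E).
Proof.
apply: inj_comp; first exact: joint_inj.
apply: (@can_inj _ _ _ (tmap idfun (@unjoint B E))).
apply: tensor_extP => [a x y|a x y|x y] //; first by rewrite !tmapP.
by rewrite !tmap_pure ?jointK //; [exact: unjoint_linear|exact: joint_linear].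
Qed.

Lemma joint3_pure A B E (f : F A) (s : tensor (F B) (F E)) :
  joint3 (pure f s) = f ⋆ joint s.
Proof. by rewrite /joint3 tmap_pure ?joint_pure //; exact: joint_linear. Qed.

Lemma joint3_assoc_pure A B E (s : tensor (F A) (F B)) (f : F E) :
  joint3 (tassoc (pure s f)) = assoc A B E ∘ (joint s ⋆ f).
Proof.
move: s; apply: tensor_extP => [a x y|a x y|x y].
- by rewrite pure_linl linearP joint3_linear.
- by rewrite joint_linear conv_linl comp_linr.
- by rewrite tassoc_pure joint3_pure !joint_pure conv_assoc.
Qed.

(** After the injective [joint3] the two sides are the iterated comultiplications of the comonoid P,
    precomposed with h; they agree by [conv_assoc] on three identities. *)
Fact fcomul_coassoc h :
  tmap idfun fcomul (fcomul h) = tassoc (tmap fcomul idfun (fcomul h)).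
Proof.
apply: joint3_inj.
have L (s : tensor H H) :
    joint3 (tmap idfun fcomul s) = (idm P ⊗m delta) ∘ joint s.
  move: s; apply: tensor_extP => [a x y|a x y|x y].
  - by rewrite tmapP joint3_linear.
  - by rewrite joint_linear comp_linr.
  - rewrite tmap_pure //; last exact: fcomul_linear.
    by rewrite joint3_pure joint_fcomul conv_compr joint_pure.
have R (s : tensor H H) : joint3 (tassoc (tmap fcomul idfun s)) =
    assoc P P P ∘ (delta ⊗m idm P) ∘ joint s.
  move: s; apply: tensor_extP => [a x y|a x y|x y].
  - by rewrite tmapP linearP joint3_linear.
  - by rewrite joint_linear comp_linr.
  - rewrite tmap_pure //; last exact: fcomul_linear.
    by rewrite joint3_assoc_pure joint_fcomul conv_compl joint_pure compA.
rewrite L R joint_fcomul !compA; congr (_ ∘ _).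
rewrite -compA -conv_compr -conv_compl !compm1.
by rewrite conv_assoc.
Qed.

(** The associator is trivial because [conv_assoc] matches the associator of D with the plain
    reassociation of vector spaces, without a correcting factor. *)
Definition qbi_Phi : tensor H (tensor H H) := 1.

Fact qbi_coassoc h : tmap idfun fcomul (fcomul h) =
  qbi_Phi * tassoc (tmap fcomul idfun (fcomul h)) * qbi_Phi^-1.
Proof. by rewrite invr1 mulr1 mul1r fcomul_coassoc. Qed.

Fact qbi_pentagon :
  tmap idfun (tmap idfun fcomul) qbi_Phi * tassoc (tmap fcomul idfun qbi_Phi) =
  pure 1 qbi_Phi
    * tmap idfun (@tassoc _ _ _ _) (tmap idfun (tmap fcomul idfun) qbi_Phi)
    * tmap idfun (@tassoc _ _ _ _) (tassoc (pure qbi_Phi 1))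
    :> tensor H (tensor H (tensor H H)).
Proof.
have c1 : fcomul 1 = 1 by exact: rmorph1.
rewrite /qbi_Phi !one_pure !(tmap_pure, tassoc_pure) //; try exact: linearP;
  try exact: tmapP; try exact: fcomul_linear.
by rewrite /= c1 !one_pure !tassoc_pure !mul_pure !mulr1.
Qed.

Fact qbi_counit :
  tmap idfun (tlift (fun a b => fcounit a *: b)) qbi_Phi = pure 1 1.
Proof.
rewrite /qbi_Phi one_pure tmap_pure //; last exact: tlift_is_linear.
rewrite one_pure tlift_pure; first by rewrite [fcounit 1]rmorph1 scale1r.
split=> [k|h] a x y; first by rewrite fcounit_linear scalerDl scalerA.
by rewrite scalerDr !scalerA mulrC.
Qed.

Definition fiber_bialgebra : quasi_bialgebra K :=
  @QuasiBialgebra K H fcomul fcounit qbi_Phi (unitr1 _)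
    qbi_coassoc fcomul_counitl fcomul_counitr qbi_pentagon qbi_counit.
End Reconstruction.

(** * Duals under the fibre functor and the antipode *)

Section Duality.
Variables (K : fieldType) (D : monoidal_category K) (w : fiber D).
Local Notation P := (gen w).
Local Notation F A := (hom P A).
Local Notation H := (endop w).
Local Notation "f ⋆ g" := (conv w f g) (at level 40, left associativity).
Local Notation eps := (eps w).
Implicit Types A B : D.

Section Pairing.
Variables (A Ad : D) (ev : hom (Ad ⊗ A) 𝟙).

Definition pairing (b : F Ad) (a : F A) : K^o := eps_coord (ev ∘ (b ⋆ a)).

Lemma pairing_linl a : linear (fun b => pairing b a).
Proof. by move=> c x y; rewrite /pairing conv_linl comp_linr eps_coord_linear. Qed.

Lemma pairing_linr b : linear (pairing b).
Proof. by move=> c x y; rewrite /pairing conv_linr comp_linr eps_coord_linear. Qed.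

Lemma pairingE b a : ev ∘ (b ⋆ a) = (pairing b a : K) *: eps.
Proof. exact: eps_coordE. Qed.

(** Invariance of the form: h slides through [delta] and [ev] and then acts on the unit by the
    counit. The antipode axiom for [alpha] follows from it. *)
Lemma pairing_fcomul h b a :
  tlift (fun x y => pairing (b ∘ x) (a ∘ y)) (fcomul h) =
  (fcounit h : K) *: pairing b a.
Proof.
have E (t : tensor H H) : tlift (fun x y => pairing (b ∘ x) (a ∘ y)) t =
    eps_coord (ev ∘ (b ⊗m a) ∘ joint t).
  move: t; apply: (tlift_eq (U := K^o)) => [|c x y|x y].
  - split=> [y|x] c u v; first by rewrite comp_linr pairing_linl.
    by rewrite comp_linr pairing_linr.
  - by rewrite joint_linear comp_linr eps_coord_linear.
  - by rewrite joint_pure -compA -conv_nat.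
rewrite E joint_fcomul -compA (compA _ (delta w)) -conv_delta compA pairingE.
by rewrite compZl eps_comp scalerA eps_coordZ mulrC.
Qed.

Section Copairing.
Variables (coev : hom 𝟙 (A ⊗ Ad)) (assocV : hom (Ad ⊗ (A ⊗ Ad)) (Ad ⊗ A ⊗ Ad)).
Hypothesis aI : inverse (assoc Ad A Ad) assocV.
Hypothesis zig :
  runit A ∘ (idm A ⊗m ev) ∘ assoc A Ad A ∘ (coev ⊗m idm A) = lunit A.
Hypothesis zag :
  lunit Ad ∘ (ev ⊗m idm Ad) ∘ assocV ∘ (idm Ad ⊗m coev) = runit Ad.

Definition copairing : tensor (F A) (F Ad) := unjoint (coev ∘ eps).

Lemma joint_copairing : joint copairing = coev ∘ eps.
Proof. exact: unjointK. Qed.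

(** The zigzag identity seen through the functor: the copairing is the tensor of dual bases, which
    makes the pairing nondegenerate on this side. *)
Lemma copairing_zig a :
  tlift (fun p q => (pairing q a : K) *: p) copairing = a.
Proof.
have E t : tlift (fun p q => (pairing q a : K) *: p) t =
    runit A ∘ (idm A ⊗m ev) ∘ assoc A Ad A ∘ (joint t ⋆ a).
  move: t; apply: tlift_eq => [|c x y|p q].
  - split=> [q|p] c x y; first by rewrite scalerDr !scalerA mulrC.
    by rewrite pairing_linl scalerDl scalerA.
  - by rewrite joint_linear conv_linl !comp_linr.
  - rewrite joint_pure -compA conv_assoc -compA -conv_compr pairingE.
    by rewrite convZr compZr conv_runit.
by rewrite E joint_copairing conv_compl compA zig conv_lunit.
Qed.

Lemma copairing_zag b :
  tlift (fun p q => (pairing b p : K) *: q) copairing = b.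
Proof.
have E t : tlift (fun p q => (pairing b p : K) *: q) t =
    lunit Ad ∘ (ev ⊗m idm Ad) ∘ assocV ∘ (b ⋆ joint t).
  move: t; apply: tlift_eq => [|c x y|p q].
  - split=> [q|p] c x y; last by rewrite scalerDr !scalerA mulrC.
    by rewrite pairing_linr scalerDl scalerA.
  - by rewrite joint_linear conv_linr !comp_linr.
  - rewrite joint_pure -conv_assoc -[RHS]compA (compA assocV) aI.1 comp1m.
    by rewrite -compA -conv_compl pairingE convZl compZr conv_lunit.
by rewrite E joint_copairing conv_compr compA zag conv_runit.
Qed.

Lemma pairing_injr a a' : (forall b, pairing b a = pairing b a') -> a = a'.
Proof.
move=> E; rewrite -(copairing_zig a) -(copairing_zig a').
by apply: eq_tlift => p q; rewrite E.
Qed.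

Lemma pairing_injl b b' : (forall a, pairing b a = pairing b' a) -> b = b'.
Proof.
move=> E; rewrite -(copairing_zag b) -(copairing_zag b').
by apply: eq_tlift => p q; rewrite E.
Qed.

Lemma copairing_act h :
  @ext_act K H H (fmod w A) (fmod w Ad) (fcomul h) copairing =
  (fcounit h : K) *: copairing.
Proof.
apply: joint_inj; rewrite joint_act (linear_scale _ _ (@joint_linear _ _ _ _ _)).
by rewrite joint_copairing -compA eps_comp compZr.
Qed.

(** The mate of m under the duality of A and Ad. It reduces a form on any Y to the pairing on Ad, so
    that a property of the antipode proved for the dual of P spreads to all objects. *)
Lemma transpose Y (m : hom (Y ⊗ A) 𝟙) : exists t : hom Y Ad,
  forall (y : F Y) (a : F A), pairing (t ∘ y) a = eps_coord (m ∘ (y ⋆ a)).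
Proof.
have [aV [a1 a2]] := assoc_iso Y A Ad.
have [rV [r1 r2]] := runit_iso Y.
pose t := lunit Ad ∘ (m ⊗m idm Ad) ∘ aV ∘ (idm Y ⊗m coev) ∘ rV.
have tE y : t ∘ y = tlift (fun p q => eps_coord (m ∘ (y ⋆ p)) *: q) copairing.
  have rVy : rV ∘ y = y ⋆ eps by rewrite -[y in LHS]conv_runit compA r1 comp1m.
  rewrite /t -compA rVy -compA -conv_compr -joint_copairing.
  move: copairing => s; apply/esym; move: s.
  apply: tlift_eq => [|c u v|p q].
  - split=> [q|p] c u v; last by rewrite scalerDr !scalerA mulrC.
    by rewrite conv_linr comp_linr eps_coord_linear scalerDl scalerA.
  - by rewrite joint_linear conv_linr !comp_linr.
  - rewrite joint_pure -conv_assoc -[RHS]compA (compA aV) a1 comp1m.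
    by rewrite -compA -conv_compl [in RHS](eps_coordE (m ∘ _)) convZl compZr conv_lunit.
exists t => y a.
rewrite tE (tlift_comp _ _ (pairing_linl a)) -[in RHS](copairing_zig a).
have l : linear (fun x => eps_coord (m ∘ (y ⋆ x)) : K^o).
  by move=> c u v; rewrite conv_linr comp_linr eps_coord_linear.
rewrite (tlift_comp _ _ l); apply: eq_tlift => p q.
rewrite (linear_scale _ _ l) (linear_scale _ _ (pairing_linl a)).
exact: mulrC.
Qed.
End Copairing.
End Pairing.

Section Antipode.
Variables (Q : D) (ev : hom (Q ⊗ P) 𝟙) (coev : hom 𝟙 (P ⊗ Q))
  (assocV : hom (Q ⊗ (P ⊗ Q)) (Q ⊗ P ⊗ Q)).
Hypothesis aI : inverse (assoc Q P Q) assocV.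
Hypothesis zig :
  runit P ∘ (idm P ⊗m ev) ∘ assoc P Q P ∘ (coev ⊗m idm P) = lunit P.
Hypothesis zag :
  lunit Q ∘ (ev ⊗m idm Q) ∘ assocV ∘ (idm Q ⊗m coev) = runit Q.

(** The transpose, for the pairing of F Q with F P, of the action of h on F Q; it is evaluated at
    the identity and expanded in the dual bases. *)
Definition fantipode (h : H) : H :=
  tlift (fun p q => (pairing ev (q ∘ h) (idm P) : K) *: p) (copairing coev).

Lemma fantipode_linear : linear fantipode.
Proof.
apply: (@tlift_param K (F P) (F Q) H H (fun h p q =>
  (pairing ev (q ∘ h) (idm P) : K) *: p)) => p q a x y.
by rewrite comp_linr pairing_linl scalerDl scalerA.
Qed.
HB.instance Definition _ := GRing.isLinear.Build K H H _ fantipode fantipode_linear.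

Lemma pairing_fantipode1 h b :
  pairing ev b (fantipode h) = pairing ev (b ∘ h) (idm P).
Proof.
rewrite /fantipode (tlift_comp _ _ (pairing_linr ev b)).
have l : linear (fun x => pairing ev (x ∘ h) (idm P)).
  by move=> c u v; rewrite comp_linl pairing_linl.
rewrite -[in RHS](copairing_zag aI zag b) (tlift_comp _ _ l).
apply: eq_tlift => p q.
rewrite (linear_scale _ _ l) (linear_scale _ _ (pairing_linr ev b)).
exact: mulrC.
Qed.

(* [fantipode h] acts on every object as the transpose of the action of [h] on its
   left dual. *)
Lemma pairing_fantipode B Bd (evB : hom (Bd ⊗ B) 𝟙) h b a :
  pairing evB b (a ∘ fantipode h) = pairing evB (b ∘ h) a.
Proof.
have [t tE] := transpose zig (evB ∘ (idm Bd ⊗m a)).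
have tE' y p : pairing ev (t ∘ y) p = pairing evB y (a ∘ p).
  by rewrite tE -compA -conv_compr.
by rewrite -tE' pairing_fantipode1 -compA tE' compm1.
Qed.

Lemma fantipode1 : fantipode 1 = 1.
Proof. by apply: (pairing_injr zig) => b; rewrite pairing_fantipode1 compm1. Qed.

(** Transposition reverses composites, and the pairing separates elements of F P. *)
Lemma fantipodeM h k : fantipode (h * k) = fantipode k * fantipode h.
Proof.
apply: (pairing_injr zig) => b.
by rewrite pairing_fantipode1 [RHS]pairing_fantipode pairing_fantipode1 -compA.
Qed.

Lemma fantipode_alpha h :
  tlift (fun a b => fantipode a * 1 * b) (fcomul h) = (fcounit h : K) *: 1.
Proof.
apply: (pairing_injr zig) => c.
rewrite (tlift_comp _ _ (pairing_linr ev c)).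
rewrite (linear_scale _ _ (pairing_linr ev c)) -pairing_fcomul.
by apply: eq_tlift => x y; rewrite mulr1 [LHS]pairing_fantipode comp1m.
Qed.

(** The left side is the contraction [Psi] of h acting on the copairing. The copairing is invariant
    up to the counit, and [Psi] sends it to the identity by the zigzag relation. *)
Lemma fantipode_beta h :
  tlift (fun a b => a * 1 * fantipode b) (fcomul h) = (fcounit h : K) *: 1.
Proof.
pose Psi := tlift (fun (p : F P) (q : F Q) => (pairing ev q (idm P) : K) *: p).
have E (t : tensor H H) : tlift (fun a b => a * 1 * fantipode b) t =
    Psi (@ext_act K H H (fmod w P) (fmod w Q) t (copairing coev)).
  have [El Er] := ext_act_bilin (fmod w P) (fmod w Q).
  move: t; apply: tlift_eq => [|c x y|x y].
  - split=> [b|a] c x y; first by rewrite !mulrDl -!scalerAl.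
    by rewrite fantipode_linear mulrDr -scalerAr.
  - by rewrite El [LHS]linearP.
  rewrite mulr1 -[LHS]/(fantipode y ∘ x) /fantipode (tlift_comp _ _ (comp_linl _)).
  move: (copairing coev) => s; move: s; apply: tlift_eq => [|c u v|p q].
  - split=> [q|p] c u v; first by rewrite !compZl comp_linl scalerDr !scalerA mulrC.
    by rewrite !compZl comp_linl pairing_linl scalerDl -scalerA.
  - by rewrite Er [LHS]linearP.
  rewrite (ext_act_pure (V := fmod w P) (W := fmod w Q)) /Psi tlift_pure.
    by rewrite compZl.
  split=> [b|a] c u v; first by rewrite scalerDr !scalerA mulrC.
  by rewrite pairing_linl scalerDl scalerA.
rewrite E copairing_act [LHS]linearZ; congr (_ *: _).
exact: (copairing_zig zig (idm P)).
Qed.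

(** In finite dimension injectivity is enough. The pairing of F P with F dP, where P is now the
    dual, turns the action of the antipode of h on F dP into h itself, so h vanishes with its
    antipode. *)
Lemma fantipode_bij (dP : D) : left_dual dP P -> bijective fantipode.
Proof.
move=> [ev' [coev' [aV [aI' zig' zag']]]].
apply: (linear_inj_bij fantipode_linear); apply: (linear_inj0 fantipode_linear) => h h0.
rewrite -[h]comp1m; apply: (pairing_injl aI' zag') => a.
rewrite -pairing_fantipode h0 comp0r.
rewrite (linear_0E (pairing_linr ev' _)).
by rewrite (linear_0E (pairing_linl ev' a)).
Qed.

Lemma tlift3_fixed_mid (f g : H -> H) (x y z : H) : linear f -> linear g ->
  tlift (fun a => tlift (fun b c => f a * x * b * y * g c))
    (1 : tensor H (tensor H H)) = f 1 * x * 1 * y * g 1.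
Proof.
move=> fl gl; rewrite one_pure tlift_pure; first rewrite one_pure tlift_pure //.
- split=> [c|b] d u v; first by rewrite mulrDr !mulrDl -!(scalerAl, scalerAr).
  by rewrite gl mulrDr -scalerAr.
- split=> [t|a]; last exact: tlift_is_linear.
  apply: (@tlift_param K H H H H (fun a b c => f a * x * b * y * g c)) => b c d u v.
  by rewrite fl !mulrDl -!scalerAl.
Qed.

Lemma tlift3_fixed_ends (f : H -> H) (x y : H) : linear f ->
  tlift (fun a => tlift (fun b c => a * x * f b * y * c))
    (1 : tensor H (tensor H H)) = 1 * x * f 1 * y * 1.
Proof.
move=> fl; rewrite one_pure tlift_pure; first rewrite one_pure tlift_pure //.
- split=> [c|b] d u v; first by rewrite fl mulrDr !mulrDl -!(scalerAl, scalerAr).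
  by rewrite mulrDr -scalerAr.
- split=> [t|a]; last exact: tlift_is_linear.
  apply: (@tlift_param K H H H H (fun a b c => a * x * f b * y * c)) => b c d u v.
  by rewrite !mulrDl -!scalerAl.
Qed.

Lemma fantipode_Phi : tlift (fun a => tlift (fun b c =>
      a * 1 * fantipode b * 1 * c)) (Phi (fiber_bialgebra w)) = 1.
Proof.
by rewrite (@tlift3_fixed_ends fantipode 1 1 fantipode_linear) fantipode1 !mulr1.
Qed.

Lemma fantipode_PhiV : tlift (fun a => tlift (fun b c =>
      fantipode a * 1 * b * 1 * fantipode c)) (Phi (fiber_bialgebra w))^-1 = 1.
Proof.
have fl := fantipode_linear.
by rewrite [_^-1]invr1 (@tlift3_fixed_mid _ _ 1 1 1 fl fl) fantipode1 !mulr1.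
Qed.

Definition fiber_hopf dP (dual : left_dual dP P) : quasi_hopf_algebra K :=
  @QuasiHopfAlgebra K (fiber_bialgebra w) fantipode 1 1
    fantipode1 fantipodeM (fantipode_bij dual)
    fantipode_alpha fantipode_beta fantipode_Phi fantipode_PhiV.
End Antipode.
End Duality.

(** * Equivalences from fully faithful dense functors *)

Section FullyFaithful.
Variables (K : fieldType) (C D : lin_category K) (F : lin_functor C D).
Hypothesis faithful : forall (X Y : C) (f g : hom X Y),
  fhom F f = fhom F g -> f = g.
Hypothesis full : forall (X Y : C) (g : hom (F X) (F Y)), exists f, fhom F f = g.
Hypothesis dense : forall V : D, exists X, isomorphic (F X) V.

(** Objects, isomorphisms and preimages of morphisms are chosen; the functor laws of the
    quasi-inverse are checked after applying F, where the chosen isomorphisms cancel. *)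
Lemma fully_faithful_equivalence : is_equivalence F.
Proof.
pose pre (X Y : C) (g : hom (F X) (F Y)) := sval (cid (full g)).
have preK X Y (g : hom (F X) (F Y)) : fhom F (pre X Y g) = g := svalP (cid (full g)).
pose Gob V := sval (cid (dense V)).
pose iso V := cid (svalP (cid (dense V))).
pose u V : hom (F (Gob V)) V := sval (iso V).
pose uV V : hom V (F (Gob V)) := sval (cid (svalP (iso V))).
have [uVK uK] : (forall V, uV V ∘ u V = idm _) /\ (forall V, u V ∘ uV V = idm _).
  by split=> V; case: (svalP (cid (svalP (iso V)))).
pose Gh V W (f : hom V W) := pre _ _ (uV W ∘ f ∘ u V).
have GhE V W (f : hom V W) : fhom F (Gh V W f) = uV W ∘ f ∘ u V by exact: preK.
have Gl V W : linear (Gh V W).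
  move=> a f g; apply: faithful; rewrite fhom_linear !GhE.
  by rewrite compDr compZr compDl compZl.
have G1 V : Gh V V (idm V) = idm (Gob V).
  by apply: faithful; rewrite GhE compm1 uVK fhom1.
have GM V W U (g : hom W U) (f : hom V W) : Gh V U (g ∘ f) = Gh W U g ∘ Gh V W f.
  apply: faithful; rewrite fhomM !GhE !compA.
  by rewrite -(compA _ (u W) (uV W)) uK compm1.
exists (LinFunctor Gl G1 GM); split.
- exists (fun X => pre _ _ (u (F X))); split=> [X|X Y f].
    exists (pre _ _ (uV (F X))); split; apply: faithful;
      by rewrite fhomM fhom1 !preK ?uK ?uVK.
  by apply: faithful; rewrite !fhomM !preK /= !compA uK comp1m.
- exists u; split=> [V|V W f]; first by exists (uV V); split; [exact: uVK|exact: uK].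
  by rewrite /= GhE !compA uK comp1m.
Qed.
End FullyFaithful.

(** * The tensor equivalence with modules *)

Section Equivalence.
Variables (K : fieldType) (D : monoidal_category K) (w : fiber D).
Hypotheses (reg : regular_homs D) (spl : split_idempotents D) (sums : has_sums D).
Local Notation P := (gen w).
Local Notation F A := (hom P A).
Local Notation H := (endop w).
Local Notation "f ⋆ g" := (conv w f g) (at level 40, left associativity).
Local Notation eps := (eps w).
Implicit Types A B : D.

(* Finite families [h i : P -> A] amount to one morphism from a power of [P],
   so von Neumann regularity provides a projection onto their span. *)
Lemma span_projection A n (h : 'I_n -> F A) : exists e : hom A A,
  [/\ e ∘ e = e, forall i, e ∘ h i = h i &
      forall f : F A, exists c : 'I_n -> H, e ∘ f = \sum_i h i ∘ c i].
Proof.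
have [X [inj [proj [pi pij _]]]] := sums (fun _ : 'I_n => P).
pose g := \sum_i h i ∘ proj i.
have gi i : g ∘ inj i = h i.
  rewrite /g comp_suml (bigD1 i) //= big1 ?addr0 => [|j ji].
    by rewrite -compA pi compm1.
  by rewrite -compA pij // comp0r.
have [r grg] := reg g; exists (g ∘ r); split=> [|i|f].
- by rewrite compA grg.
- by rewrite -gi !compA grg.
- exists (fun i => proj i ∘ r ∘ f); rewrite -compA /g comp_suml.
  by apply: eq_bigr => i _; rewrite !compA.
Qed.

(** A left ideal of the opposite algebra is stable under precomposition, so the idempotent e built
    from a basis of I satisfies I = e ∘ H, and the kernel of e ∘ - is a complementary ideal. *)
Lemma endop_semisimple : semisimple_algebra H.
Proof.
move=> I Il; pose h (i : 'I_(\dim I)) : H := (vbasis I)`_i.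
have [e [ee eh espan]] := span_projection h.
pose L := linfun (lin_pack (comp_linr e) : {linear H -> H}).
have LE x : L x = e ∘ x by rewrite lfunE.
have eI x : x \in I -> e ∘ x = x.
  move=> /coord_vbasis->; rewrite comp_sumr; apply: eq_bigr => i _.
  by rewrite compZr eh.
have Ie x : e ∘ x \in I.
  have [c ->] := espan x; apply: memv_suml => i _.
  apply: (subvP Il); rewrite -[h i ∘ c i]/((c i : H) * h i).
  by rewrite memv_mul ?memvf // vbasis_mem ?mem_nth ?size_tuple.
exists (lker L); split.
- apply/prodvP => a x _; rewrite !memv_ker !LE -[a * x]/(x ∘ a) compA => /eqP->.
  by rewrite comp0l.
- apply/eqP; rewrite eqEsubv subvf; apply/subvP => x _.
  apply/memv_addP; exists (e ∘ x) => //; exists (x - e ∘ x); last by rewrite addrC subrK.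
  by rewrite memv_ker LE compBr compA ee subrr.
- apply/eqP; rewrite -subv0; apply/subvP=> x /memv_capP[/eI xI].
  by rewrite memv_ker LE xI memv0.
Qed.

Lemma fmod_hom_subproof A B (g : hom A B) (h : H) (f : fmod w A) :
  linfun (lin_pack (comp_linr g) : {linear fmod w A -> fmod w B}) (act h f) =
  act h (linfun (lin_pack (comp_linr g) : {linear fmod w A -> fmod w B}) f : fmod w B).
Proof. by rewrite !lfunE /= /fmod_act compA. Qed.
Definition fmod_hom A B (g : hom A B) : rep_hom (fmod w A) (fmod w B) :=
  mk_rep_hom (fmod_hom_subproof g).

Lemma fmod_homE A B (g : hom A B) (f : F A) : vsval (fmod_hom g) f = g ∘ f.
Proof. exact: lfunE. Qed.

Fact fmod_hom_linear A B : linear (@fmod_hom A B).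
Proof.
move=> a f g; apply: rep_hom_ext => x.
rewrite fmod_homE [in RHS]linearP add_lfunE scale_lfunE !fmod_homE.
by rewrite compDl compZl.
Qed.
Fact fmod_hom1 A : fmod_hom (idm A) = rep_id (fmod w A).
Proof. by apply: rep_hom_ext => x; rewrite fmod_homE rep_idE comp1m. Qed.
Fact fmod_homM A B E (g : hom B E) (f : hom A B) :
  fmod_hom (g ∘ f) = rep_comp (fmod_hom g) (fmod_hom f).
Proof. by apply: rep_hom_ext => x; rewrite rep_compE !fmod_homE compA. Qed.

Definition fib : lin_functor D (Rep (fiber_bialgebra w)) :=
  @LinFunctor K D (rep_lin_category H) (@fmod K D w) fmod_hom
    fmod_hom_linear fmod_hom1 fmod_homM.

Lemma fib_faithful A B (f g : hom A B) : fhom fib f = fhom fib g -> f = g.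
Proof.
move=> fg; have E (x : F A) : f ∘ x = g ∘ x by rewrite -!fmod_homE [fmod_hom f]fg.
have [n [i [p ip]]] := gen_cover w A.
rewrite -[f]compm1 -[g]compm1 -ip !comp_sumr; apply: eq_bigr => k _.
by rewrite !compA E.
Qed.

(** The cover writes f as a sum of i k ∘ (p k ∘ f), where p k ∘ f lies in H; an intertwiner is
    therefore determined by its values at the i k, and these define g. *)
Lemma fib_full A B (phi : rep_hom (fmod w A) (fmod w B)) :
  exists g : hom A B, fmod_hom g = phi.
Proof.
have [n [i [p ip]]] := gen_cover w A.
exists (\sum_k (vsval phi (i k) : F B) ∘ p k).
apply: rep_hom_ext => f; rewrite fmod_homE -[f in RHS]comp1m -ip.
rewrite !comp_suml linear_sum; apply: eq_bigr => k _.
by rewrite -!compA; exact: (esym (rep_homA phi (p k ∘ f : H) (i k))).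
Qed.

(** A free cover: X is a sum of copies of P, one for each basis vector of V, and [pr] is the
    resulting surjection of F X onto V. Its kernel is the range of an idempotent e of X, hence V is
    the image of a complementary summand. *)
Lemma fib_dense (V : module H) :
  exists A, @isomorphic K (rep_lin_category H) (fmod w A) V.
Proof.
pose v (i : 'I_(\dim {: V})) : V := (vbasis fullv)`_i.
have [X [inj [proj [pi pij _]]]] := sums (fun _ : 'I_(\dim {: V}) => P).
have [Al Ar] := act_bilin V.
pose pr (f : F X) : V := \sum_i act (proj i ∘ f : H) (v i).
have prl : linear pr.
  move=> a x y; rewrite /pr scaler_sumr -big_split; apply: eq_bigr => i _ /=.
  by rewrite comp_linr Al.
have prA f (h : H) : pr (f ∘ h) = act h (pr f).
  rewrite /pr (linear_sumE _ _ _ (Ar h)); apply: eq_bigr => i _.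
  by rewrite compA -[_ ∘ h]/((h : H) * (proj i ∘ f)) actM.
have pr_inj j : pr (inj j) = v j.
  rewrite /pr (bigD1 j) //= big1 ?addr0 => [|i ij].
    by rewrite pi [LHS]act1.
  by rewrite pij // (linear_0E (Al (v i))).
pose N := lker (linfun (lin_pack prl)).
have NE x : (x \in N) = (pr x == 0) by rewrite memv_ker lin_packE.
pose g (j : 'I_(\dim N)) : F X := (vbasis N)`_j.
have [e [ee eg espan]] := span_projection g.
have eN x : x \in N -> e ∘ x = x.
  move=> /coord_vbasis->; rewrite comp_sumr; apply: eq_bigr => i _.
  by rewrite compZr eg.
have pre x : pr (e ∘ x) = 0.
  have [c ->] := espan x; rewrite (linear_sumE _ _ _ prl) big1 // => j _.
  rewrite prA; suff /eqP-> : pr (g j) == 0 by rewrite (linear_0E (Ar (c j))).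
  by rewrite -NE vbasis_mem ?mem_nth ?size_tuple.
(* A is split off by id - e, the complement of the kernel of [pr]. *)
have [A [i [p [pi' ip]]]] := spl (idm_sub_idem ee).
have ei : e ∘ i = 0.
  rewrite -[ i]compm1 -pi' (compA i) ip compA compBr compm1 ee subrr.
  by rewrite comp0l.
pose th (f : F A) : V := pr (i ∘ f).
have thl : linear th by move=> a x y; rewrite /th comp_linr prl.
have th0 f : th f = 0 -> f = 0.
  move=> /eqP; rewrite -NE => /eN; rewrite compA ei comp0l => if0.
  by rewrite -[f]comp1m -pi' -compA -if0 comp0r.
have ths y : exists f, th f = y.
  pose x := \sum_j coord (vbasis fullv) j y *: inj j.
  have prx : pr x = y.
    rewrite (linear_sumE _ _ _ prl) [RHS](coord_vbasis (memvf y)).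
    by apply: eq_bigr => j _; rewrite (linear_scale _ _ prl) pr_inj.
  exists (p ∘ x); rewrite /th compA ip compBl comp1m.
  by rewrite addrC -scaleN1r prl pre scaler0 add0r.
pose s y := sval (cid (ths y)).
have sK : cancel s th by move=> y; apply: svalP (cid (ths y)).
have thK : cancel th s.
  by move=> f; apply: (linear_inj0 thl th0); rewrite sK.
pose th' : {linear fmod w A -> V} := lin_pack thl.
have thA a f : linfun th' (act a f) = act a (linfun th' f).
  by rewrite !lfunE /= /th /fmod_act compA prA.
exists A, (mk_rep_hom thA).
apply: (@rep_is_iso K H (fmod w A) V (mk_rep_hom thA) s).
- exact: linear_cancel thl thK sK.
- by move=> f; exact: etrans (congr1 s (lin_packE thl f)) (thK f).
- by move=> y; exact: etrans (lin_packE thl (s y)) (sK y).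
Qed.

Lemma fib_equivalence : is_equivalence fib.
Proof.
apply: fully_faithful_equivalence.
- exact: fib_faithful.
- by move=> A B g; have [f <-] := fib_full g; exists f.
- exact: fib_dense.
Qed.

Definition joint_lin A B :
    {linear rep_tensor (H := fiber_bialgebra w) (fmod w A) (fmod w B) -> fmod w (A ⊗ B)} :=
  lin_pack (@joint_linear K D w A B).

Lemma fib_tensor_subproof A B (h : H)
    (x : rep_tensor (H := fiber_bialgebra w) (fmod w A) (fmod w B)) :
  linfun (joint_lin A B) (act h x) =
  act h (linfun (joint_lin A B) x : fmod w (A ⊗ B)).
Proof. by rewrite !lfunE; exact: joint_act. Qed.
Definition fib_tensor A B :
    rep_hom (rep_tensor (H := fiber_bialgebra w) (fmod w A) (fmod w B)) (fmod w (A ⊗ B)) :=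
  mk_rep_hom (@fib_tensor_subproof A B).
Lemma fib_tensorE A B x : vsval (fib_tensor A B) x = joint x.
Proof. exact: lfunE. Qed.

Lemma unit_lin_subproof : linear (fun c : K^o => (c : K) *: eps).
Proof. by move=> a x y; rewrite scalerDl scalerA. Qed.
Definition unit_lin : {linear rep_unit (fiber_bialgebra w) -> fmod w 𝟙} :=
  lin_pack unit_lin_subproof.
Lemma fib_unit_subproof (h : H) (c : rep_unit (fiber_bialgebra w)) :
  linfun unit_lin (act h c) = act h (linfun unit_lin c : fmod w 𝟙).
Proof.
by rewrite !lfunE /= /fmod_act /unit_act compZl eps_comp scalerA mulrC.
Qed.
Definition fib_unit : rep_hom (rep_unit (fiber_bialgebra w)) (fmod w 𝟙) :=
  mk_rep_hom fib_unit_subproof.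
Lemma fib_unitE c : vsval fib_unit c = (c : K) *: eps.
Proof. exact: lfunE. Qed.

Lemma fib_monoidal : monoidal_functor fib.
Proof.
exists fib_tensor, fib_unit; split.
- split=> [A B|].
    apply: (@rep_is_iso K H (rep_tensor (H := fiber_bialgebra w) (fmod w A) (fmod w B))
      (fmod w (A ⊗ B)) (fib_tensor A B) (@unjoint K D w A B)).
    + exact: unjoint_linear.
    + by move=> x; rewrite fib_tensorE jointK.
    + by move=> x; rewrite fib_tensorE unjointK.
  apply: (@rep_is_iso K H (rep_unit (fiber_bialgebra w)) (fmod w 𝟙) fib_unit (@eps_coord K D w)).
  + exact: eps_coord_linear.
  + by move=> x; rewrite fib_unitE eps_coordZ.
  + by move=> x; rewrite fib_unitE -eps_coordE.
- move=> A A' B B' f g; apply: rep_hom_ext => x.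
  rewrite !rep_compE fib_tensorE rep_omapE fmod_homE fib_tensorE.
  move: x; apply: tensor_extP => [a x y|a x y|x y].
  + by rewrite tmapP joint_linear.
  + by rewrite joint_linear comp_linr.
  + by rewrite tmap_pure ?joint_pure ?fmod_homE ?conv_nat //; exact: linearP.
- move=> A B E; apply: rep_hom_ext => x.
  rewrite !rep_compE rep_assocE !rep_omapE fmod_homE !fib_tensorE.
  rewrite /act3 /= ext_act1.
  move: x; apply: tensor_ext3l => [a x y|a x y|f g h].
  + by rewrite tmapP joint_linear comp_linr.
  + by rewrite linearP tmapP joint_linear.
  + rewrite tassoc_pure !tmap_pure; try exact: linearP.
    by rewrite !lfunE /= -!/(joint _) !joint_pure conv_assoc.
- move=> A; apply: rep_hom_ext => x.
  rewrite !rep_compE rep_omapE rep_lunitE fmod_homE fib_tensorE.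
  move: x; apply: tensor_extP => [a x y|a x y|c f].
  + by rewrite tmapP joint_linear comp_linr.
  + by rewrite linearP.
  + rewrite tmap_pure; try exact: linearP.
    by rewrite fib_unitE rep_idE joint_pure convZl compZr conv_lunit lunit_pure.
- move=> A; apply: rep_hom_ext => x.
  rewrite !rep_compE rep_omapE rep_runitE fmod_homE fib_tensorE.
  move: x; apply: tensor_extP => [a x y|a x y|f c].
  + by rewrite tmapP joint_linear comp_linr.
  + by rewrite linearP.
  + rewrite tmap_pure; try exact: linearP.
    by rewrite fib_unitE rep_idE joint_pure convZr compZr conv_runit runit_pure.
Qed.
End Equivalence.

(** * The module category generated by an outside object *)

Section Coherence.
Variables (K : fieldType) (C : monoidal_category K).
Implicit Types X Y Z A B E : C.

Lemma iso_comp0 X Y Z (f : hom Y Z) (g : hom X Y) : is_iso f -> f ∘ g = 0 -> g = 0.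
Proof. by case=> h [hf _] fg; rewrite -[g]comp1m -hf -compA fg comp0r. Qed.

Lemma iso_epi X Y Z (f : hom X Y) (g h : hom Y Z) :
  is_iso f -> g ∘ f = h ∘ f -> g = h.
Proof.
by case=> k [_ fk] gh; rewrite -[g]compm1 -[h]compm1 -fk !compA gh.
Qed.

Lemma iso_mono X Y Z (f : hom Y Z) (g h : hom X Y) :
  is_iso f -> f ∘ g = f ∘ h -> g = h.
Proof.
by case=> k [kf _] gh; rewrite -[g]comp1m -[h]comp1m -kf -!compA gh.
Qed.

Lemma omap_iso X X' Y Y' (f : hom X X') (g : hom Y Y') :
  is_iso f -> is_iso g -> is_iso (f ⊗m g).
Proof.
move=> [f' [f1 f2]] [g' [g1 g2]]; exists (f' ⊗m g').
by split; rewrite -omapM ?f1 ?g1 ?f2 ?g2 omap1.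
Qed.

Lemma idm_iso X : is_iso (idm X).
Proof. by exists (idm X); split; rewrite comp1m. Qed.

(** Naturality of the left unit constraint conjugates 𝟙 ⊗ - to the identity functor. *)
Lemma omap_unit_inj X Y (f g : hom X Y) :
  idm (𝟙 : C) ⊗m f = idm 𝟙 ⊗m g -> f = g.
Proof. by move=> fg; apply: (iso_epi (lunit_iso X)); rewrite -!lunit_nat fg. Qed.

Definition assocV X Y Z : hom (X ⊗ (Y ⊗ Z)) (X ⊗ Y ⊗ Z) :=
  sval (cid (assoc_iso X Y Z)).
Lemma assocVK X Y Z : inverse (assoc X Y Z) (assocV X Y Z).
Proof. exact: svalP (cid (assoc_iso X Y Z)). Qed.
Definition lunitV X : hom X (𝟙 ⊗ X) := sval (cid (lunit_iso X)).
Lemma lunitVK X : inverse (lunit X) (lunitV X).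
Proof. exact: svalP (cid (lunit_iso X)). Qed.

Lemma assocV_nat X X' Y Y' Z Z' (f : hom X X') (g : hom Y Y') (h : hom Z Z') :
  omap (omap f g) h ∘ assocV X Y Z = assocV X' Y' Z' ∘ omap f (omap g h).
Proof.
apply: (iso_mono (assoc_iso X' Y' Z')); rewrite !compA assoc_nat.
by rewrite (assocVK _ _ _).2 comp1m -compA (assocVK _ _ _).2 compm1.
Qed.

(* Kelly's redundancy of the left unit triangle. *)
Lemma lunit_otimes X Y : lunit (X ⊗ Y) ∘ assoc 𝟙 X Y = lunit X ⊗m idm Y.
Proof.
apply: omap_unit_inj; apply: (iso_epi (assoc_iso 𝟙 (𝟙 ⊗ X) Y)).
apply: (iso_epi (omap_iso (assoc_iso 𝟙 𝟙 X) (idm_iso Y))).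
have -> : idm 𝟙 ⊗m (lunit (X ⊗ Y) ∘ assoc 𝟙 X Y) =
    (idm 𝟙 ⊗m lunit (X ⊗ Y)) ∘ (idm 𝟙 ⊗m assoc 𝟙 X Y).
  by rewrite -omapM comp1m.
rewrite -!compA (compA (idm 𝟙 ⊗m assoc 𝟙 X Y)) -pentagon compA triangle.
rewrite -(omap1 X Y) -assoc_nat -triangle.
rewrite compA -assoc_nat -compA; congr (_ ∘ _).
by rewrite -omapM comp1m.
Qed.

(** Injectivity of the adjunction map from Hom (T, B ⊗ X) to Hom (Bd ⊗ T, 𝟙 ⊗ X): tensoring the
    transpose with B and inserting [coev] returns i up to isomorphism. *)
Lemma dual_transpose_inj B Bd (ev : hom (Bd ⊗ B) 𝟙) (coev : hom 𝟙 (B ⊗ Bd))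
    T X (i : hom T (B ⊗ X)) :
  runit B ∘ (idm B ⊗m ev) ∘ assoc B Bd B ∘ (coev ⊗m idm B) = lunit B ->
  (ev ⊗m idm X) ∘ assocV Bd B X ∘ (idm Bd ⊗m i) = 0 -> i = 0.
Proof.
move=> zig; set phi := _ ∘ assocV _ _ _ => phi0.
pose Th := (idm B ⊗m phi) ∘ assoc B Bd (B ⊗ X) ∘ (coev ⊗m idm (B ⊗ X)).
have Thi : Th ∘ (idm 𝟙 ⊗m i) = 0.
  rewrite /Th -compA omap_interchange -(omap1 B Bd) compA -(compA _ (assoc _ _ _)).
  by rewrite assoc_nat compA -omapM comp1m phi0 omap0r !comp0l.
pose R := (idm B ⊗m ev) ∘ assoc B Bd B ∘ (coev ⊗m idm B).
(* The pentagon brings the zigzag composite R, acting on B alone, out of Th. *)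
have ThR : Th ∘ assoc 𝟙 B X = assoc B 𝟙 X ∘ (R ⊗m idm X).
  rewrite /Th -(omap1 B X) -!compA -assoc_nat (compA (assoc _ _ _)) pentagon.
  have -> : R ⊗m idm X = ((idm B ⊗m ev) ⊗m idm X) ∘ (assoc B Bd B ⊗m idm X)
      ∘ ((coev ⊗m idm B) ⊗m idm X) by rewrite -!omapM !comp1m.
  have pa : phi ∘ assoc Bd B X = ev ⊗m idm X.
    by rewrite /phi -compA (assocVK _ _ _).1 compm1.
  by rewrite !compA assoc_nat -(omapM (idm B) (idm B) phi) comp1m pa.
have lR : runit B ∘ R = lunit B by rewrite /R !compA zig.
have : (R ⊗m idm X) ∘ (assocV 𝟙 B X ∘ (idm 𝟙 ⊗m i)) = 0.
  apply: (iso_comp0 (assoc_iso B 𝟙 X)); rewrite !compA -ThR -(compA Th).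
  by rewrite (assocVK _ _ _).2 compm1.
move/(congr1 (fun f => (runit B ⊗m idm X) ∘ f)).
rewrite compA -omapM lR comp1m comp0r.
move/(iso_comp0 (omap_iso (lunit_iso B) (idm_iso X))).
have aVi : is_iso (assocV 𝟙 B X).
  by exists (assoc 𝟙 B X); have [? ?] := assocVK 𝟙 B X.
move/(iso_comp0 aVi) => z; apply: omap_unit_inj.
by rewrite z omap0r.
Qed.

(** A nonzero evaluation onto the unit has a section, so X is a retract of (Ad ⊗ A) ⊗ X and hence of
    Ad ⊗ (A ⊗ X), which would vanish with A ⊗ X. *)
Lemma otimes_neq0 A Ad X : regular_homs C -> scalar_simple (𝟙 : C) ->
  left_dual A Ad -> idm A != 0 -> idm X != 0 -> idm (A ⊗ X) != 0.
Proof.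
move=> reg s1 [ev [coev [aV [_ zig _]]]] A0 X0; apply: contra X0 => /eqP AX0.
have ev0 : ev != 0.
  apply: contra A0 => /eqP ev0.
  move: zig; rewrite ev0 omap0r comp0r !comp0l => /esym l0.
  by rewrite -(lunitVK A).2 l0 comp0l.
have [s evs] := scalar_retract reg s1 ev0.
have z : idm (Ad ⊗ A ⊗ X) = 0.
  by rewrite -(assocVK Ad A X).1 -[assoc _ _ _]comp1m -omap1 AX0 omap0r comp0l comp0r.
rewrite -(lunitVK X).2 -[lunit X]compm1 -omap1 -evs -(comp1m (idm X)) omapM.
by rewrite -[s ⊗m _]comp1m z comp0l !comp0r comp0l.
Qed.

Section RankOneModule.
Variable X : C.

(* The tensor structure of the functor [A |-> hom X (A ⊗ X)]. *)
Definition coact A B (f : hom X (A ⊗ X)) (g : hom X (B ⊗ X)) :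
  hom X (A ⊗ B ⊗ X) := assocV A B X ∘ (idm A ⊗m g) ∘ f.

Lemma coact_bilin A B : bilin (@coact A B).
Proof.
split=> [g|f] a x y; rewrite /coact; first by rewrite compDr compZr.
rewrite (bilinDr (@omap_bilin _ C _ _ _ _)) omapZr !compDr !compZr.
by rewrite compDl compZl.
Qed.

Lemma coact_nat A A' B B' (u : hom A A') (v : hom B B') f g :
  coact ((u ⊗m idm X) ∘ f) ((v ⊗m idm X) ∘ g) =
  ((u ⊗m v) ⊗m idm X) ∘ coact f g.
Proof.
rewrite /coact !compA assocV_nat -!(compA (assocV _ _ _)) -!omapM.
by rewrite !comp1m !compm1.
Qed.

(** This is the pentagon with inverse associators; it is the source of the trivial associator of the
    reconstructed algebra. *)
Lemma coact_assoc A B E (f : hom X (A ⊗ X)) (g : hom X (B ⊗ X))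
    (h : hom X (E ⊗ X)) :
  (assoc A B E ⊗m idm X) ∘ coact (coact f g) h = coact f (coact g h).
Proof.
have pent : (assoc A B E ⊗m idm X) ∘ assocV (A ⊗ B) E X ∘ assocV A B (E ⊗ X) =
    assocV A (B ⊗ E) X ∘ (idm A ⊗m assocV B E X).
  apply: (iso_mono (assoc_iso A (B ⊗ E) X)).
  apply: (iso_mono (omap_iso (idm_iso A) (assoc_iso B E X))).
  rewrite !compA -pentagon -(compA (assoc A B (E ⊗ X))) (assocVK _ _ _).2 compm1.
  rewrite (assocVK _ _ _).2 -(compA _ (assoc A (B ⊗ E) X)) (assocVK _ _ _).2.
  by rewrite compm1 -omapM (assocVK _ _ _).2 comp1m omap1.
rewrite /coact -(omap1 A B) !compA -(compA _ _ (assocV A B X)) assocV_nat !compA.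
rewrite pent -!compA; congr (_ ∘ _); rewrite !compA; congr (_ ∘ _).
by rewrite -!omapM !comp1m.
Qed.

Lemma coact_lunit A (f : hom X (A ⊗ X)) :
  (lunit A ⊗m idm X) ∘ coact (lunitV X) f = f.
Proof.
rewrite /coact !compA -lunit_otimes -(compA (lunit _)) (assocVK _ _ _).2 compm1.
by rewrite lunit_nat -compA (lunitVK X).2 compm1.
Qed.

Lemma coact_runit A (f : hom X (A ⊗ X)) :
  (runit A ⊗m idm X) ∘ coact f (lunitV X) = f.
Proof.
rewrite /coact !compA -triangle -(compA _ (assoc _ _ _)) (assocVK _ _ _).2 compm1.
by rewrite -omapM (lunitVK X).2 comp1m omap1 comp1m.
Qed.

(** Surjectivity half of the tensor property: h is expanded along a decomposition of B ⊗ X into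
    copies of X. *)
Lemma coact_split A B m (inj : 'I_m -> hom X (B ⊗ X)) proj
    (h : hom X (A ⊗ B ⊗ X)) : \sum_k inj k ∘ proj k = idm (B ⊗ X) ->
  \sum_k coact ((idm A ⊗m proj k) ∘ assoc A B X ∘ h) (inj k) = h.
Proof.
move=> ip; under eq_bigr => k _.
  rewrite /coact -!compA (compA (idm A ⊗m inj k)) -omapM comp1m; over.
rewrite -comp_sumr -comp_suml -omap_sumr ip omap1 comp1m compA.
by rewrite (assocVK _ _ _).1 comp1m.
Qed.

(** Injectivity half: for p with values in X, p ∘ g is a scalar, so f and the coordinates of g can
    be read off. *)
Lemma coact_proj A B (f : hom X (A ⊗ X)) (g : hom X (B ⊗ X)) Y
    (p : hom (B ⊗ X) Y) :
  (idm A ⊗m p) ∘ assoc A B X ∘ coact f g = (idm A ⊗m (p ∘ g)) ∘ f.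
Proof.
rewrite /coact !compA -(compA _ (assoc A B X)) (assocVK _ _ _).2 compm1.
by rewrite -omapM comp1m.
Qed.
End RankOneModule.
End Coherence.

(** * Representing linear functors on a semisimple category *)

Section Representatives.
Variables (K : closedFieldType) (C : lin_category K) (n : nat) (S : 'I_n -> C).
Hypotheses (ss : semisimple C) (Srep : simple_representatives S).

Lemma rep_scalar i : scalar_simple (S i).
Proof. by case: Srep => Ss _ _; apply: schur. Qed.

Lemma rep_orthogonal i j (f : hom (S i) (S j)) : i != j -> f = 0.
Proof.
case: Srep => Ss Si _ ij; apply/eqP; apply: contraT => f0.
by case/eqP: ij; apply: Si; exists f; apply: simple_hom_iso.
Qed.

Lemma rep_decomposition X : exists m (s : 'I_m -> 'I_n),
  direct_sum (fun l => S (s l)) X.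
Proof.
case: Srep => _ _ Sall; have [m [T [Ts [inj [proj [pi pij ip]]]]]] := ss.2 X.
have /choice[s sE] := fun l => Sall _ (Ts l).
pose u l := sval (cid (sE l)).
pose v l := sval (cid (svalP (cid (sE l)))).
have uv l : inverse (u l) (v l) by exact: svalP (cid (svalP (cid (sE l)))).
exists m, s, (fun l => inj l ∘ v l), (fun l => u l ∘ proj l); split=> [l|l k lk|].
- by rewrite !compA -(compA (u l)) pi compm1 (uv l).2.
- by rewrite !compA -(compA (u l)) pij // comp0r comp0l.
- rewrite -ip; apply: eq_bigr => l _.
  by rewrite !compA -(compA (inj l)) (uv l).1 compm1.
Qed.
End Representatives.

Section Representability.
Variables (K : closedFieldType) (C : lin_category K) (n : nat) (S : 'I_n -> C).
Hypotheses (ss : semisimple C) (Srep : simple_representatives S).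
Variables (W : C -> vectType K) (wm : forall A B : C, hom A B -> W A -> W B).
Hypotheses (wm_bilin : forall A B, bilin (@wm A B))
  (wm1 : forall A (x : W A), wm (idm A) x = x)
  (wmM : forall A B E (g : hom B E) (f : hom A B) x, wm (g ∘ f) x = wm g (wm f x))
  (W_neq0 : forall i, exists x : W (S i), x != 0).

(** P is the sum of the S i with multiplicity dim W (S i), one copy for each basis vector, and u is
    the element whose components are these basis vectors. No multiplicity is zero, so every simple
    summand of A factors through one copy in P, which gives the cover. *)
Theorem representable : exists (P : C) (u : W P),
  (forall A, bijective (fun f : hom P A => wm f u)) /\
  forall A, exists m (i : 'I_m -> hom P A) (p : 'I_m -> hom A P),
    \sum_k i k ∘ p k = idm A.
Proof.
have sums := semisimple_sums ss.
pose d i := \dim {: W (S i)}.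
pose Qs i := cid (sums (d i) (fun _ => S i)).
pose Q i := sval (Qs i).
pose qis i := cid (svalP (Qs i)); pose qi i : forall k, hom (S i) (Q i) := sval (qis i).
pose qps i := cid (svalP (qis i)); pose qp i : forall k, hom (Q i) (S i) := sval (qps i).
have qE i : [/\ forall k, qp i k ∘ qi i k = idm (S i),
    forall k l, k != l -> qp i k ∘ qi i l = 0 &
    \sum_k qi i k ∘ qp i k = idm (Q i)] := svalP (qps i).
have [P [Pi [Pp [PpPi Ppi PiPp]]]] := sums n Q.
pose b i (k : 'I_(d i)) : W (S i) := (vbasis fullv)`_k.
pose inj i k : hom (S i) P := Pi i ∘ qi i k.
pose proj i k : hom P (S i) := qp i k ∘ Pp i.
have sum1 : \sum_i \sum_k inj i k ∘ proj i k = idm P.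
  rewrite -PiPp; apply: eq_bigr => i _; have [_ _ q1] := qE i.
  rewrite -[Pp i]comp1m -q1 comp_suml comp_sumr; apply: eq_bigr => k _.
  by rewrite /inj /proj !compA.
have diag i k l : proj i k ∘ inj i l = if k == l then idm (S i) else 0.
  have [q1 q0 _] := qE i; rewrite /proj /inj compA -(compA _ (Pp i)) PpPi compm1.
  by case: eqVneq => [->|/q0].
have off i j k l : i != j -> proj i k ∘ inj j l = 0.
  by move=> ij; rewrite /proj /inj compA -(compA _ (Pp i)) Ppi // comp0r comp0l.
pose u : W P := \sum_i \sum_k wm (inj i k) (b i k).
have wl A B (x : W A) : linear (fun f : hom A B => wm f x) := (wm_bilin A B).1 x.
have wr A B (f : hom A B) : linear (wm f) := (wm_bilin A B).2 f.
have proj_u i k : wm (proj i k) u = b i k.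
  rewrite /u (linear_sumE _ _ _ (wr _ _ _)) (bigD1 i) //= [X in _ + X]big1 ?addr0.
    rewrite (linear_sumE _ _ _ (wr _ _ _)) (bigD1 k) //= big1 ?addr0 => [|l lk].
      by rewrite -wmM diag eqxx wm1.
    by rewrite -wmM diag eq_sym (negPf lk) (linear_0E (wl _ _ _)).
  move=> j ji; rewrite (linear_sumE _ _ _ (wr _ _ _)) big1 // => l _.
  by rewrite -wmM off ?(linear_0E (wl _ _ _)) // eq_sym.
exists P, u; split=> A; last first.
  have [m [s [Ai [Ap [_ _ AE]]]]] := rep_decomposition ss Srep A.
  have d0 i : (0 < d i)%N.
    rewrite lt0n dimv_eq0; have [x x0] := W_neq0 i.
    by apply: contra x0 => /eqP E; rewrite -memv0 -E memvf.
  exists m, (fun l => Ai l ∘ proj (s l) (Ordinal (d0 _))).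
  exists (fun l => inj (s l) (Ordinal (d0 _)) ∘ Ap l).
  rewrite -AE; apply: eq_bigr => l _.
  by rewrite compA -(compA (Ai l)) diag eqxx compm1.
(* On the copies of S i the morphism h is a family of scalars, and applying it to u gives a linear
   relation among basis vectors of W (S i). *)
have inj_simple i (h : hom P (S i)) : wm h u = 0 -> h = 0.
  move=> hu; rewrite -[h]compm1 -sum1 comp_sumr big1 // => j _.
  rewrite comp_sumr big1 // => l _; rewrite compA.
  suff -> : h ∘ inj j l = 0 by rewrite comp0l.
  have [|ij] := eqVneq j i; last exact: rep_orthogonal ss Srep _ _ _ ij.
  move=> ji; move: l; rewrite ji => l.
  have [_ sc] := rep_scalar ss Srep i.
  pose c k := sval (cid (sc (h ∘ inj i k))).
  have cE k : h ∘ inj i k = c k *: idm _ := svalP (cid (sc (h ∘ inj i k))).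
  have : \sum_k c k *: (vbasis {: W (S i)})`_k = 0.
    rewrite -[RHS]hu /u (linear_sumE _ _ _ (wr _ _ _)) (bigD1 i) //=.
    rewrite [X in _ = _ + X]big1 ?addr0.
      rewrite (linear_sumE _ _ _ (wr _ _ _)); apply: eq_bigr => k _.
      by rewrite -wmM cE (linear_scale _ _ (wl _ _ _)) wm1.
    move=> j' ji'; rewrite (linear_sumE _ _ _ (wr _ _ _)) big1 // => k _.
    rewrite -wmM (rep_orthogonal ss Srep (h ∘ inj j' k) ji').
    by rewrite (linear_0E (wl _ _ _)).
  have /freeP/(_ c) fr := basis_free (vbasisP {: W (S i)}).
  move/fr/(_ l) => c0.
  by rewrite cE c0 scale0r.
have [m [s [Ai [Ap [_ _ AE]]]]] := rep_decomposition ss Srep A.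
have phi_inj : injective (fun f : hom P A => wm f u).
  apply: (linear_inj0 (wl P A u)) => f fu.
  rewrite -[f]comp1m -AE comp_suml big1 // => l _.
  rewrite -compA (inj_simple _ (Ap l ∘ f)) ?comp0r //.
  by rewrite wmM fu (linear_0E (wr _ _ _)).
have phi_surj (y : W A) : exists f : hom P A, wm f u = y.
  exists (\sum_l \sum_k coord (vbasis fullv) k (wm (Ap l) y) *: (Ai l ∘ proj (s l) k)).
  rewrite -[RHS]wm1 -AE (linear_sumE _ _ _ (wl P A u)) (linear_sumE _ _ _ (wl A A y)).
  apply: eq_bigr => l _; rewrite (linear_sumE _ _ _ (wl _ _ _)) wmM.
  rewrite [in RHS](coord_vbasis (memvf (wm (Ap l) y))) [RHS](linear_sumE _ _ _ (wr _ _ _)).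
  apply: eq_bigr => k _; rewrite (linear_scale _ _ (wl _ _ _)).
  by rewrite wmM proj_u (linear_scale _ _ (wr _ _ _)).
pose g y := sval (cid (phi_surj y)).
have gK y : wm (g y) u = y := svalP (cid (phi_surj y)).
by exists g => // f; apply: phi_inj; rewrite /= gK.
Qed.
End Representability.

(** * Fusion subcategories of maximal rank *)

Section MaximalRank.
Variables (K : closedFieldType) (C : monoidal_category K).
Variable D : fusion_subcategory C.
Hypotheses (ssC : semisimple C) (rgC : rigid C) (unitC : simple_object (𝟙 : C)).

Lemma sub_isomorphic (X Y : C) : isomorphic X Y -> D Y -> D X.
Proof. by move=> [f [g [gf _]]]; apply: sub_retract gf. Qed.

(** The simples of D inject into the n classes of C, because simplicity and isomorphism are the same
    in both; one class is left over. *)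
Lemma unique_simple_outside n : has_rank C n -> has_rank D n.-1 ->
  exists X : C, [/\ simple_object X, ~ D X &
    forall Z : C, simple_object Z -> ~ D Z -> isomorphic Z X].
Proof.
move=> [S [Ss Si Sall]] [T [Ts Ti Tall]].
have /choice[s sE] : forall j, exists i, isomorphic (sval (T j)) (S i).
  by move=> j; apply: Sall; apply: simple_sub.
have s_inj : injective s.
  move=> j j' jj'; apply: Ti; have := isomorphic_sym (sE j'); rewrite -jj'.
  exact: (isomorphic_trans (sE j)).
(* For [n = 0] the predecessor [n.-1] would be 0 too; the unit object excludes this case. *)
have n0 : (0 < n)%N.
  by have [i _] := Sall _ unitC; case: (n) i => // -[].
have /eqP/cards1P[x xE] : #|~: [set s j | j in setT]| = 1%N.
  by rewrite cardsCs setCK card_imset // cardsT !card_ord -subn1 subKn.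
have notx j : s j != x.
  have : x \in ~: [set s j | j in setT] by rewrite xE set11.
  by rewrite inE; apply: contraNneq => <-; apply: imset_f.
exists (S x); split=> // [DSx|Z Zs DZ].
  have [j jx] := Tall _ (@sub_simple K C D ssC (exist _ (S x) DSx) (Ss x)).
  case/eqP: (notx j); apply: Si; apply: isomorphic_trans (isomorphic_sym (sE j)) _.
  exact: (isomorphic_sym jx).
have [y yE] := Sall _ Zs.
suff : y \in ~: [set s j | j in setT] by rewrite xE inE => /eqP <-.
rewrite inE; apply/negP => /imsetP[j _ yj]; apply: DZ.
apply: sub_isomorphic (svalP (T j)).
by apply: isomorphic_trans yE _; rewrite yj; apply: isomorphic_sym.
Qed.

Section Outside.
Variable X : C.
Hypotheses (Xs : simple_object X) (DX : ~ D X)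
  (Xu : forall Z : C, simple_object Z -> ~ D Z -> isomorphic Z X).

Lemma outside_isotypic (B : C) : D B ->
  exists m (inj : 'I_m -> hom X (B ⊗ X)) proj,
    \sum_k inj k ∘ proj k = idm (B ⊗ X).
Proof.
move=> DB; have [m [T [Ts [inj [proj [pi _ ip]]]]]] := ssC.2 (B ⊗ X).
have DT l : ~ D (T l).
  move=> DTl; have [[Bd BBd] _] := rgC B.
  have [ev [coev [_ [_ zig _]]]] := BBd.
  (* The transpose of the inclusion of T l. It is nonzero, so X simple makes it split, and X becomes
     a retract of Bd ⊗ T l, an object of D. *)
  pose f := lunit X ∘ ((ev ⊗m idm X) ∘ assocV Bd B X ∘ (idm Bd ⊗m inj l)).
  have f0 : f != 0.
    apply/eqP => /(iso_comp0 (lunit_iso X))/(dual_transpose_inj zig) i0.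
    by have /eqP[] := simple_idm_neq0 (Ts l); rewrite -(pi l) i0 comp0r.
  have [g fg] := scalar_retract (semisimple_regular ssC) (schur ssC Xs) f0.
  apply: DX; apply: sub_retract fg _.
  by apply: sub_otimes => //; apply: sub_left_dual BBd DB.
pose u l := sval (cid (Xu (Ts l) (@DT l))).
pose v l := sval (cid (svalP (cid (Xu (Ts l) (@DT l))))).
have uv l : inverse (u l) (v l) by exact: svalP (cid (svalP (cid (Xu (Ts l) (@DT l))))).
exists m, (fun l => inj l ∘ v l), (fun l => u l ∘ proj l).
rewrite -ip; apply: eq_bigr => l _.
by rewrite !compA -(compA (inj l)) (uv l).1 compm1.
Qed.

Definition outside_hom (A : D) : vectType K := hom X (sval A ⊗ X).
Definition outside_map (A B : D) (f : hom A B) (x : outside_hom A) : outside_hom B :=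
  ((f : hom (sval A) (sval B)) ⊗m idm X) ∘ x.

Lemma outside_map_bilin A B : bilin (@outside_map A B).
Proof.
split=> [x|f] a y z; rewrite /outside_map; last by rewrite compDr compZr.
by rewrite (bilinDl (@omap_bilin _ C _ _ _ _)) omapZl compDl compZl.
Qed.

Lemma outside_map1 A (x : outside_hom A) : outside_map (idm A) x = x.
Proof. by rewrite /outside_map omap1 comp1m. Qed.

Lemma outside_mapM A B E (g : hom B E) (f : hom A B) x :
  outside_map (g ∘ f) x = outside_map g (outside_map f x).
Proof. by rewrite /outside_map compA -omapM comp1m. Qed.

(** A ⊗ X is nonzero and a sum of copies of X. This is the positivity that makes the representing
    object a generator. *)
Lemma outside_hom_neq0 (A : D) : idm A != 0 -> exists x : outside_hom A, x != 0.
Proof.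
move=> A0; have [m [inj [proj ip]]] := outside_isotypic (svalP A).
apply: contrapT => no.
have z k : inj k = 0.
  by apply/eqP; apply: contrapT => h; apply: no; exists (inj k); apply/negP.
have [[Ad AAd] _] := rgC (sval A).
have /eqP[] := otimes_neq0 (semisimple_regular ssC) (schur ssC unitC) AAd A0
  (simple_idm_neq0 Xs).
by rewrite -ip big1 // => k _; rewrite z comp0l.
Qed.

(** The structure [coact] is carried to Hom (P, -) along the Yoneda bijection [phi], and its
    identities are verified after applying [phi]. *)
Lemma fiber_exists n : has_rank D n -> inhabited (fiber D).
Proof.
move=> [S Srep]; have ssD := sub_semisimple D ssC.
have [] := representable ssD Srep outside_map_bilin outside_map1 outside_mapM.
  by move=> i; apply: outside_hom_neq0; apply: simple_idm_neq0; case: Srep.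
move=> P [u [bij cover]].
pose phi A (f : hom P A) : outside_hom A := outside_map f u.
have phil A : linear (phi A) := (outside_map_bilin P A).1 u.
have phi_inj A : injective (phi A) := bij_inj (bij A).
have phi_surj A y : exists f, phi A f = y.
  by have [g _ gK] := bij A; exists (g y); apply: gK.
pose psi A y := sval (cid (phi_surj A y)).
have psiK A y : phi A (psi A y) = y := svalP (cid (phi_surj A y)).
have phiK A f : psi A (phi A f) = f by apply: phi_inj; rewrite psiK.
have psil A : linear (psi A) := linear_cancel (phil A) (phiK A) (psiK A).
have phiM A B (g : hom A B) f : phi B (g ∘ f) =
    @omap K C (sval A) (sval B) X X g (idm X) ∘ phi A f.
  exact: outside_mapM.
pose cv (A B : D) (f : hom P A) (g : hom P B) : hom P (A ⊗ B) :=
  psi (A ⊗ B) (coact (phi A f) (phi B g)).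
have cvE A B (f : hom P A) (g : hom P B) :
  phi (A ⊗ B) (cv A B f g) = coact (phi A f) (phi B g) := psiK _ _.
pose e : hom P (𝟙 : D) := psi 𝟙 (lunitV X).
have eE : phi 𝟙 e = lunitV X := psiK _ _.
have sX := schur ssC Xs.
apply: inhabits; apply: (@Fiber K D P cv e).
- move=> A B; split=> [g|f] a x y; rewrite /cv phil.
    by rewrite (@coact_bilin K C X (sval A) (sval B)).1 psil.
  by rewrite (@coact_bilin K C X (sval A) (sval B)).2 psil.
- move=> A A' B B' a b f g; apply: phi_inj.
  by rewrite cvE !phiM coact_nat cvE.
- move=> A B E f g h; apply: phi_inj.
  by rewrite phiM !cvE coact_assoc.
- by move=> A f; apply: phi_inj; rewrite phiM cvE eE coact_lunit.
- by move=> A f; apply: phi_inj; rewrite phiM cvE eE coact_runit.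
- move=> A B; have [m [inj [proj ip]]] := outside_isotypic (svalP B).
  have cvb : bilin (cv A B).
    split=> [g|f] a x y; rewrite /cv phil.
      by rewrite (@coact_bilin K C X (sval A) (sval B)).1 psil.
    by rewrite (@coact_bilin K C X (sval A) (sval B)).2 psil.
  (* The inverse of the tensor structure: a decomposition of B ⊗ X cuts h into components X -> A ⊗
     X, each paired with its inclusion X -> B ⊗ X. *)
  pose back (h : hom P (A ⊗ B)) : tensor (hom P A) (hom P B) :=
    \sum_k pure (psi A ((idm _ ⊗m proj k) ∘ assoc _ _ X ∘ phi _ h))
                (psi B (inj k)).
  have backl : linear back.
    move=> a x y; rewrite /back phil scaler_sumr -big_split; apply: eq_bigr => k _ /=.
    by rewrite compDr compZr psil pure_linl.
  exists back; last first.
    move=> h; rewrite /back (linear_sumE _ _ _ (tlift_is_linear _)).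
    apply: phi_inj; rewrite (linear_sumE _ _ _ (phil _)) -[RHS](coact_split _ ip).
    by apply: eq_bigr => k _; rewrite tlift_pure // cvE !psiK.
  apply: tensor_extP => [a x y|a x y|f g] //; first by rewrite tlift_is_linear backl.
  rewrite tlift_pure // /back cvE.
  (* The coordinates of g are scalars since End X is; they move from the first leg to the second,
     where they reassemble g. *)
  pose c k := sval (cid (sX.2 (proj k ∘ phi B g))).
  have cE k : proj k ∘ phi B g = c k *: idm X := svalP (cid (sX.2 (proj k ∘ phi B g))).
  rewrite -[in RHS](phiK B g) -[phi B g in RHS]comp1m -[in RHS]ip comp_suml.
  rewrite (linear_sumE _ _ _ (psil B)) (linear_sumE _ _ _ (pure_linr _)).
  apply: eq_bigr => k _; rewrite coact_proj -compA cE.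
  rewrite omapZr omap1 compZl comp1m compZr compm1.
  rewrite (linear_scale _ _ (psil A)) (linear_scale _ _ (psil B)) phiK.
  by rewrite (linear_scale _ _ (pure_linl _)) (linear_scale _ _ (pure_linr _)).
(* Hom (X, 𝟙 ⊗ X) is identified with End X by the left unit constraint, hence it is
   one-dimensional. *)
- move=> f; have [c cE] := sX.2 (lunit X ∘ phi 𝟙 f); exists c.
  apply: phi_inj; rewrite (linear_scale _ _ (phil _)) eE.
  by rewrite -[LHS]comp1m -(lunitVK X).1 -compA cE compZr compm1.
- apply/eqP => P0; case/eqP: sX.1; rewrite -(lunitVK X).2 -eE.
  by rewrite -[e]compm1 P0 comp0r (linear_0E (phil _)) comp0r.
- exact: cover.
Qed.
End Outside.
End MaximalRank.

(** * Dimensions of the fibres *)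

Section Dimension.

Lemma dim_hom_direct_sum (K : fieldType) (C : lin_category K) n (T : 'I_n -> C)
  (A Y : C) : direct_sum T A ->
  \dim {: hom Y A} = (\sum_l \dim {: hom Y (T l)})%N.
Proof.
move=> [inj [proj [pi pij ip]]].
pose L l := linfun (lin_pack ((@comp_bilin K C Y (T l) A).2 (inj l))).
have LE l f : L l f = inj l ∘ f by rewrite lin_packE.
have dimL l : \dim (limg (L l)) = \dim {: hom Y (T l)}.
  apply: limg_dim_eq; suff /eqP-> : lker (L l) == 0%VS by rewrite capv0.
  apply/lker0P => f g; rewrite !LE => fg.
  by rewrite -[f]comp1m -[g]comp1m -(pi l) -!compA fg.
have full : {: hom Y A}%VS = (\sum_l limg (L l))%VS.
  apply/eqP; rewrite eqEsubv subvf andbT; apply/subvP => f _.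
  rewrite -[f]comp1m -ip comp_suml; apply: memv_sumr => l _.
  by rewrite -compA -LE memv_img ?memvf.
have dx : directv (\sum_l limg (L l))%VS.
  apply/directv_sum_independent => us usL us0 l _.
  have /memv_imgP[g _] := usL l isT; rewrite LE => ul.
  have <- : inj l ∘ (proj l ∘ \sum_i us i) = us l.
    rewrite comp_sumr (bigD1 l) //= big1 ?addr0 => [|j jl].
      by rewrite ul !compA -(compA (inj l)) pi compm1.
    have /memv_imgP[g' _ ->] := usL j isT.
    by rewrite LE compA pij ?comp0l // eq_sym.
  by rewrite us0 !comp0r.
by rewrite full (directvP dx) /=; apply: eq_bigr => l _; rewrite dimL.
Qed.

Section Fiber.
Variables (K : closedFieldType) (D : monoidal_category K) (w : fiber D).
Hypothesis ss : semisimple D.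
Local Notation P := (gen w).
Definition fdim (A : D) := \dim {: hom P A}.

Lemma fdimM A B : fdim (A ⊗ B) = (fdim A * fdim B)%N.
Proof.
rewrite /fdim -(linear_dim (@joint_linear K D w A B) (@jointK K D w A B)
  (@unjointK K D w A B)).
by rewrite !dimvf.
Qed.

Lemma fdim_gt0 A : idm A != 0 -> (0 < fdim A)%N.
Proof.
move=> A0; rewrite lt0n dimv_eq0; apply: contra A0 => /eqP F0.
have [n [i [p <-]]] := gen_cover w A; rewrite big1 // => k _.
have : i k \in {: hom P A}%VS by exact: memvf.
by rewrite F0 memv0 => /eqP->; rewrite comp0l.
Qed.

Variables (n : nat) (S : 'I_n -> D).
Hypothesis Srep : simple_representatives S.

Lemma dim_hom_rep i j : \dim {: hom (S i) (S j)} = (i == j).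
Proof.
case: eqVneq => [<-|ij].
  have [nz sc] := rep_scalar ss Srep i.
  suff -> : {: hom (S i) (S i)}%VS = <[idm (S i)]>%VS by rewrite dim_vline nz.
  apply/eqP; rewrite eqEsubv subvf andbT; apply/subvP=> f _.
  by apply/vlineP; apply: sc.
apply/eqP; rewrite dimv_eq0 -subv0; apply/subvP=> f _.
by rewrite (rep_orthogonal ss Srep f ij) mem0v.
Qed.

(** The dimension of Hom (S i, A) is the multiplicity of S i in A. At A = X ⊗ S j, together with
    [fdimM], this is the eigenvector equation of the fusion matrix. *)
Lemma fdim_sum A : fdim A = (\sum_i fdim (S i) * \dim {: hom (S i) A})%N.
Proof.
have [m [s sA]] := rep_decomposition ss Srep A.
rewrite /fdim (dim_hom_direct_sum _ sA).
under [in RHS]eq_bigr => i _ do rewrite (dim_hom_direct_sum _ sA) big_distrr.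
rewrite exchange_big; apply: eq_bigr => l _ /=.
rewrite (bigD1 (s l)) //= dim_hom_rep eqxx muln1 big1 ?addn0 // => i il.
by rewrite dim_hom_rep (negPf il) muln0.
Qed.
End Fiber.
End Dimension.

(** * Frobenius-Perron dimensions *)

Section PerronFrobenius.
Import Order.TTheory Num.Theory.

(** For another eigenvector y take the index j where |y j| / v j is largest. There |x| |y j| is at
    most the sum of the |y i| N i j, which is at most d |y j| by comparison with v. *)
Lemma positive_eigenvector (R : realFieldType) n (N : 'M[R]_n) (v : 'rV[R]_n) d :
  (0 < n)%N -> (forall i j, 0 <= N i j) -> (forall i, 0 < v 0 i) ->
  v *m N = d *: v ->
  eigenvalue N d /\ forall x, eigenvalue N x -> x <= d.
Proof.
move=> n0 N0 v0 vN; split=> [|x /eigenvalueP[y yN y0]].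
  apply/eigenvalueP; exists v => //; apply/eqP => /rowP/(_ (Ordinal n0)).
  by rewrite mxE => E; have := v0 (Ordinal n0); rewrite E ltxx.
have [i0 yi0] : exists i, y 0 i != 0.
  apply/existsP; apply: contraNT y0; rewrite negb_exists => /forallP z.
  by apply/eqP/rowP => i; rewrite mxE; apply/eqP; have := z i; rewrite negbK.
pose c i := `|y 0 i| / v 0 i.
have [j _ jmax] := @Order.TotalTheory.arg_maxP _ _ _ i0 xpredT c isT.
have yc i : `|y 0 i| <= c j * v 0 i.
  by rewrite -ler_pdivrMr ?v0 //; apply: jmax.
have cj : 0 < c j.
  by apply: lt_le_trans (jmax i0 isT); rewrite divr_gt0 ?normr_gt0.
have yj : `|y 0 j| = c j * v 0 j by rewrite /c divfK // gt_eqF.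
have yj0 : 0 < `|y 0 j| by rewrite yj mulr_gt0.
rewrite -(ler_pM2r yj0); apply: le_trans (ler_wpM2r (ltW yj0) (ler_norm x)) _.
rewrite -normrM; have -> : x * y 0 j = \sum_i y 0 i * N i j.
  by have /rowP/(_ j) := yN; rewrite !mxE.
apply: le_trans (ler_norm_sum _ _ _) _.
have -> : d * `|y 0 j| = \sum_i c j * v 0 i * N i j.
  have /rowP/(_ j) := vN; rewrite !mxE yj mulrCA => <-; rewrite mulr_sumr.
  by apply: eq_bigr => i _; rewrite mulrA.
apply: ler_sum => i _; rewrite normrM (ger0_norm (N0 i j)).
by rewrite ler_wpM2r.
Qed.
End PerronFrobenius.

Lemma fiber_integral (K : closedFieldType) (D : monoidal_category K)
  (w : fiber D) (R : realFieldType) : semisimple D -> is_integral D R.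
Proof.
move=> ss n S Srep X Xs; exists (Posz (fdim w X)); rewrite -pmulrn.
have S1 i : idm (S i) != 0 by have [] := rep_scalar ss Srep i.
have n0 : (0 < n)%N by case: Srep => _ _ /(_ X Xs)[i _]; case: (n) i => // -[].
(* A row vector fits because the first index of the fusion matrix is the constituent S i of X ⊗ S j,
   over which [fdim_sum] sums. *)
have [|||ev max] := @positive_eigenvector R n (fusion_matrix R S X)
  (\row_j (fdim w (S j))%:R) (fdim w X)%:R n0.
- by move=> i j; rewrite mxE Num.Theory.ler0n.
- by move=> i; rewrite mxE Num.Theory.ltr0n fdim_gt0.
- apply/rowP => j; rewrite !mxE -natrM -fdimM (fdim_sum w ss Srep) natr_sum.
  by apply: eq_bigr => i _; rewrite !mxE natrM.
- by split; rewrite ?Num.Theory.ler0n.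
Qed.

Theorem proposition3p2 (R : realType) (C : monoidal_category R[i])
  (D : fusion_subcategory C) (n : nat) :
  is_fusion C -> has_rank C n -> has_rank D n.-1 ->
  (is_fusion D /\ is_integral D R) /\
  exists H : quasi_hopf_algebra R[i],
    semisimple_algebra H /\ tensor_equivalent D (Rep H).
Proof.
move=> [ssC rgC _ unitC] rankC rankD.
have ssD := sub_semisimple D ssC.
have rgD := sub_rigid rgC (D := D).
have [X [Xs DX Xu]] := unique_simple_outside ssC unitC rankC rankD.
have [w] := fiber_exists ssC rgC unitC Xs DX Xu rankD.
split; first split.
- by split=> //; [exists n.-1 | apply: sub_simple].
- exact: fiber_integral.
(* Both duals of P are used: Q, its left dual, defines the antipode, and dP, whose left dual is P,
   makes it bijective. *)
have [[Q [ev [coev [aV [aI zig zag]]]]] [dP dual]] := rgD (gen w).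
exists (fiber_hopf aI zig zag dual); split.
  exact: endop_semisimple (sub_regular ssC) (sub_sums ssC).
exists (fib w); split; last exact: fib_monoidal.
by apply: fib_equivalence; [apply: sub_regular|apply: sub_split|apply: sub_sums].
Qed.
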